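(* Let $M>0$. Let $(\varepsilon_n)_{n\in\mathbb Z}$ be an i.i.d. sequence of $[0,\infty)$-valued random variables and let $(Y_n)_{n\in\mathbb Z}$ be a strictly stationary $[0,M]$-valued process independent of $(\varepsilon_n)_{n\in\mathbb Z}$, with $\mathbb E[Y_0]<\mathbb E[\varepsilon_1]$. Assume there is $\eta>0$ such that the limit $$\Gamma(a):=\lim_{n\to\infty}\frac1n\ln\mathbb E\,e^{a(Y_1+\ldots+Y_n)}$$ exists for all $a\in(-\eta,\eta)$ and $\Gamma$ is differentiable on $(-\eta,\eta)$. Let $\bar\alpha>0$ be such that, with $\gamma(y):=\mathbb E[e^{\bar\alpha(y-\varepsilon_1)}]$ and $K:=e^{\bar\alpha M}$, $$\bar\gamma:=\limsup_{n\to\infty}\left(\mathbb E\left[K\prod_{k=1}^n\gamma(Y_k)\right]\right)^{1/n}<1$$ (such $\bar\alpha$ exists under the preceding assumptions), and assume that $\mathbb P(\varepsilon_1\ge\tau)>0$ for $$\tau:=M+\frac{4}{\frac{1}{\bar\gamma^{1/2}}-1}.$$ Let $W_{n+1}=(W_n+Y_n-\varepsilon_{n+1})_+$, $n\in\mathbb N$, with deterministic $W_0\ge0$. Then there exists a probability measure $\mu_*$ on $\mathcal B([0,\infty))$, independent of $W_0$, such that $$d_{TV}(\mathrm{Law}(W_n),\mu_* )\le c_1e^{-c_2n^{1/3}},\qquad n\in\mathbb N,$$ for some $c_1,c_2>0$. Furthermore, if $(Y_n)_{n\in\mathbb Z}$ is ergodic, then for every bounded measurable $\Phi:[0,\infty)\to\mathbb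 R$, $$\frac{\Phi(W_0)+\ldots+\Phi(W_{n-1})}{n}\to\int_{[0,\infty)}\Phi(z)\,\mu_*(dz),\qquad n\to\infty,$$ in $L^p$ for all $1\le p<\infty$.
   Context: $x_+=\max(x,0)$. $d_{TV}(\mu_1,\mu_2)=|\mu_1-\mu_2|([0,\infty))$ is the total mass of the total variation of $\mu_1-\mu_2$. A stationary process $(Y_n)_{n\in\mathbb Z}$ is ergodic if its law on the path space gives probability $0$ or $1$ to every measurable set $A$ of paths with $S^{-1}(A)=A$, where $S$ is the left shift $(S\mathbf y)_j=\mathbf y_{j+1}$. Interpretation: $Y_n$ are service times, $\varepsilon_n$ inter-arrival times and $W_n$ waiting times in a single-server queue. *)

(* Defs.v *)
From HB Require Import structures.
From mathcomp Require Import all_boot all_order all_algebra.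
From mathcomp Require Import all_classical all_reals all_analysis.
From mathcomp Require Import measurable_realfun.

Set Implicit Arguments.
Unset Strict Implicit.
Unset Printing Implicit Defensive.

Import Order.TTheory GRing.Theory Num.Theory.
Import numFieldNormedType.Exports.

Local Open Scope classical_set_scope.
Local Open Scope ring_scope.

Definition path_measurable (R : realType) : set (set (int -> R)) :=
  <<s \bigcup_(n : int)
        preimage_set_system [set: int -> R] (fun y => y n) measurable >>.

Definition path_of (R : realType) (T : Type) (X : int -> T -> R) (t : T)
  : int -> R := fun n => X n t.

Definition path_law (d : measure_display) (T : measurableType d)
    (R : realType) (P : probability T R) (X : int -> T -> R)
    (A : set (int -> R)) : \bar R :=
  P (path_of X @^-1` A).

Definition left_shift (R : realType) (y : int -> R) : int -> R :=
  fun j => y (j + 1).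

Definition strictly_stationary (d : measure_display) (T : measurableType d)
    (R : realType) (P : probability T R) (X : int -> T -> R) : Prop :=
  forall (k : int) (A : set (int -> R)), path_measurable A ->
    path_law P (fun n => X (n + k)) A = path_law P X A.

Definition ergodic (d : measure_display) (T : measurableType d)
    (R : realType) (P : probability T R) (X : int -> T -> R) : Prop :=
  forall A : set (int -> R), path_measurable A ->
    @left_shift R @^-1` A = A ->
    path_law P X A = 0%E \/ path_law P X A = 1%E.

Definition mutually_independent (d : measure_display) (T : measurableType d)
    (R : realType) (P : probability T R) (X : int -> T -> R) : Prop :=
  forall (s : seq int) (B : int -> set R), uniq s ->
    (forall i, measurable (B i)) ->
    P (\big[setI/setT]_(i <- s) (X i @^-1` B i)) =
    (\prod_(i <- s) P (X i @^-1` B i))%E.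

Definition identically_distributed (d : measure_display)
    (T : measurableType d) (R : realType) (P : probability T R)
    (X : int -> T -> R) : Prop :=
  forall (i j : int) (B : set R), measurable B ->
    P (X i @^-1` B) = P (X j @^-1` B).

Definition iid (d : measure_display) (T : measurableType d)
    (R : realType) (P : probability T R) (X : int -> T -> R) : Prop :=
  mutually_independent P X /\ identically_distributed P X.

Definition independent_processes (d : measure_display)
    (T : measurableType d) (R : realType) (P : probability T R)
    (X Z : int -> T -> R) : Prop :=
  forall A B : set (int -> R), path_measurable A -> path_measurable B ->
    P (path_of X @^-1` A `&` path_of Z @^-1` B) =
    (path_law P X A * path_law P Z B)%E.

Definition measure_diff (d : measure_display) (T : measurableType d)
    (R : realType) (mu1 mu2 : {finite_measure set T -> \bar R})
  : {charge set T -> \bar R} :=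
  cadd (charge_of_finite_measure mu1) (copp (charge_of_finite_measure mu2)).

(* |nu|(A). The library's charge_variation takes a Hahn decomposition of nu
   as argument; its values on measurable sets do not depend on which one. *)
Definition total_variation_of (d : measure_display) (T : measurableType d)
    (R : realType) (nu : {charge set T -> \bar R}) (A : set T) : \bar R :=
  charge_variation (projT2 (cid (projT2 (cid (Hahn_decomposition nu))))) A.

(* Laws on [0, +oo) are represented as laws on R carried by [0, +oo). *)
Definition d_TV (R : realType) (mu1 mu2 : probability R R) : \bar R :=
  total_variation_of (measure_diff mu1 mu2) `[0, +oo[%classic.

Definition scaled_log_mgf (d : measure_display) (T : measurableType d)
    (R : realType) (P : probability T R) (Y : int -> T -> R) (a : R) (n : nat)
  : R :=
  n%:R^-1 *
  ln (fine 'E_P[fun t => expR (a * \sum_(1 <= k < n.+1) Y k%:Z t)]).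

Definition Gamma (d : measure_display) (T : measurableType d)
    (R : realType) (P : probability T R) (Y : int -> T -> R) (a : R) : R :=
  limn (scaled_log_mgf P Y a).

Definition gamma (d : measure_display) (T : measurableType d)
    (R : realType) (P : probability T R) (eps : int -> T -> R)
    (alpha y : R) : R :=
  fine 'E_P[fun t => expR (alpha * (y - eps 1 t))].

Definition gamma_bar (d : measure_display) (T : measurableType d)
    (R : realType) (P : probability T R) (Y eps : int -> T -> R)
    (M alpha : R) : \bar R :=
  limn_esup (fun n : nat =>
    'E_P[fun t => (expR (alpha * M) *
                   \prod_(1 <= k < n.+1) gamma P eps alpha (Y k%:Z t))%R]
    `^ n%:R^-1)%E.

Definition tau (R : realType) (M g : R) : R :=
  M + 4 / (1 / Num.sqrt g - 1).

Definition lindley_step (d : measure_display) (T : measurableType d)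
    (R : realType) (W Y e : {mfun T >-> R}) : {mfun T >-> R} :=
  max_mfun (W + Y - e) (cst 0).

Fixpoint waiting (d : measure_display) (T : measurableType d)
    (R : realType) (P : probability T R) (Y eps : int -> {RV P >-> R})
    (w0 : R) (n : nat) : {RV P >-> R} :=
  if n is m.+1 then lindley_step (waiting Y eps w0 m) (Y m%:Z) (eps m.+1%:Z)
  else (cst w0 : {mfun T >-> R}).

Lemma waiting0E (d : measure_display) (T : measurableType d)
    (R : realType) (P : probability T R) (Y eps : int -> {RV P >-> R})
    (w0 : R) (t : T) :
  waiting Y eps w0 0 t = w0.
Proof. by []. Qed.

Lemma waitingSE (d : measure_display) (T : measurableType d)
    (R : realType) (P : probability T R) (Y eps : int -> {RV P >-> R})
    (w0 : R) (n : nat) (t : T) :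
  waiting Y eps w0 n.+1 t =
  Num.max (waiting Y eps w0 n t + Y n%:Z t - eps n.+1%:Z t) 0.
Proof. by []. Qed.

(* Main.v *)
(* Loynes' construction gives convergence at an exponential rate, faster than
   exp(-c n^(1/3)).  On the space of paths (Y, eps) with its shift-invariant law,
   let S_n be the sum of the first n increments Y_i - eps_(i+1).  The waiting
   time started at w is max(V_n, w + S_n), where V_n is the one started at 0, so
   the two differ only if w + S_n > 0, and by Markov's inequality this has
   probability at most exp(alpha w) E[exp(alpha S_n)], which decays geometrically
   because gamma_bar < 1.  By the same estimate the queue started empty m steps
   in the past has at time 0 a waiting time that is eventually constant in m; mu
   is the law of its limit, and stationarity gives the total variation bound.

   For the law of large numbers, the m-step backward waiting time depends on
   finitely many coordinates, so the event that its centred sums are unbounded is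
   shift-invariant and insensitive to finitely many changes of eps: for fixed Y
   its probability is 0 or 1 by Kolmogorov's law, and ergodicity of Y makes it
   trivial.  The maximal ergodic lemma then gives convergence of averages, and
   m tends to infinity.

   An admissible alpha exists because Jensen's inequality for both signs of a
   forces Gamma'(0) = E[Y_0], while Fatou's lemma along alpha = 1/n shows
   liminf n (1 - E[exp(-eps_1/n)]) >= E[eps_1] > E[Y_0]. *)

Require Import Defs.
From HB Require Import structures.
From mathcomp Require Import all_boot all_order all_algebra.
From mathcomp Require Import all_classical all_reals all_analysis.
From mathcomp Require Import measurable_realfun.
From mathcomp Require Import ring lra zify.

Set Implicit Arguments.
Unset Strict Implicit.
Unset Printing Implicit Defensive.

Import Order.TTheory GRing.Theory Num.Theory.
Import numFieldNormedType.Exports.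

Local Open Scope classical_set_scope.
Local Open Scope ring_scope.

(** * Path space *)

Section measurable_packing.
Context d d' (T1 : measurableType d) (T2 : measurableType d').

Definition mfun_of (f : T1 -> T2) (mf : measurable_fun [set: T1] f) :
  {mfun T1 >-> T2} := HB.pack f (isMeasurableFun.Build _ _ _ _ f mf).

Definition image_measure (R : realType) (m : {measure set T1 -> \bar R})
    (f : T1 -> T2) (mf : measurable_fun [set: T1] f) :
    {measure set T2 -> \bar R} :=
  Measure.clone _ _ _ (pushforward m f)
    (measure_function_pushforward__canonical__measure_function_Measure m mf).

Definition image_probability (R : realType) (P : probability T1 R)
    (f : T1 -> T2) (mf : measurable_fun [set: T1] f) : probability T2 R :=
  distribution P (mfun_of mf).

Lemma image_probabilityE (R : realType) (P : probability T1 R)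
    (f : T1 -> T2) (mf : measurable_fun [set: T1] f) A :
  image_probability P mf A = P (f @^-1` A).
Proof. by []. Qed.

End measurable_packing.

Section path_space.
Variable R : realType.

Definition coordinate_sets : set (set (int -> R)) :=
  \bigcup_(n : int)
    preimage_set_system [set: int -> R] (fun y => y n) measurable.

Notation pathT := (g_sigma_algebraType coordinate_sets).

Lemma measurable_coord (n : int) :
  measurable_fun [set: pathT] (fun y : pathT => y n).
Proof.
move=> _ B mB; rewrite setTI; apply: sub_sigma_algebra.
by exists n => //; exists B => //; rewrite setTI.
Qed.

Lemma measurable_fun_path d (T : measurableType d) (f : T -> pathT) :
  (forall n, measurable_fun [set: T] (fun t => f t n)) ->
  measurable_fun [set: T] f.
Proof.
move=> mf; apply: (@measurability _ _ T pathT setT f coordinate_sets) => //.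
move=> _ [_ [n _ [B mB <-]] <-]; rewrite !setTI.
by have := mf n measurableT B mB; rewrite setTI.
Qed.

Definition cylinder (s : seq int) (B : int -> set R) : set pathT :=
  [set y | forall i, i \in s -> B i (y i)].

Lemma cylinderE s B :
  cylinder s B = \big[setI/setT]_(i <- s) ((fun y : pathT => y i) @^-1` B i).
Proof.
apply/seteqP; split=> y.
  elim: s => [|i s IH] By; first by rewrite big_nil.
  rewrite big_cons; split; first by apply: By; rewrite mem_head.
  by apply: IH => j js; apply: By; rewrite inE js orbT.
elim: s => [|i s IH]; rewrite ?big_nil// big_cons => -[Bi /IH Bs] j.
by rewrite inE => /predU1P[->//|/Bs].
Qed.

Lemma measurable_cylinder s B : (forall i, measurable (B i)) ->
  measurable (cylinder s B).
Proof.
move=> mB; rewrite cylinderE; elim: s => [|i s IH].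
  by rewrite big_nil; exact: measurableT.
rewrite big_cons; apply: measurableI => //.
by rewrite -[X in measurable X]setTI; exact: measurable_coord.
Qed.

Definition cylinders : set (set pathT) :=
  [set A | exists s B, [/\ uniq s, forall i, measurable (B i) &
    A = cylinder s B]].

Lemma sigma_cylinders : (measurable : set (set pathT)) = <<s cylinders >>.
Proof.
apply/seteqP; split; apply: smallest_sub.
- exact: smallest_sigma_algebra.
- move=> _ [n _ [B mB <-]]; apply: sub_sigma_algebra.
  exists [:: n], (fun=> B); split=> //; apply/seteqP; split => y /=.
    by move=> [_ Byn] i; rewrite inE => /eqP ->.
  by move=> By; split=> //; apply: By; rewrite inE.
- exact: sigma_algebra_measurable.
- by move=> _ [s [B [_ mB ->]]]; exact: measurable_cylinder.
Qed.

Lemma setI_closed_cylinders : setI_closed cylinders.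
Proof.
move=> _ _ [s [B [_ mB ->]]] [s' [B' [_ mB' ->]]].
exists (undup (s ++ s')), (fun i =>
  (if i \in s then B i else setT) `&` (if i \in s' then B' i else setT)).
split; first exact: undup_uniq.
  by move=> i; apply: measurableI; case: ifP.
apply/seteqP; split => y.
  by move=> [By B'y] i _; split; case: ifP => // ?; [exact: By|exact: B'y].
move=> h; split=> i is_.
  by have := h i; rewrite mem_undup mem_cat is_ => /(_ isT)[].
by have := h i; rewrite mem_undup mem_cat is_ orbT => /(_ isT)[].
Qed.

(** Cylinders are closed under intersection and generate the sigma-algebra, so two measures agreeing
    on them, finite on the whole space, coincide. *)
Lemma path_measure_unique (m1 m2 : {measure set pathT -> \bar R}) :
  (m1 setT < +oo)%E ->
  (forall s B, uniq s -> (forall i, measurable (B i)) ->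
    m1 (cylinder s B) = m2 (cylinder s B)) ->
  forall A, measurable A -> m1 A = m2 A.
Proof.
move=> m1oo m12; apply: (measure_unique cylinders (fun=> setT)) => //.
- exact: sigma_cylinders.
- exact: setI_closed_cylinders.
- move=> _; exists [::], (fun=> setT); split => //.
  by apply/seteqP; split.
- by rewrite bigcup_const//; exists 0%N.
- by move=> _ [s [B [us mB ->]]]; exact: m12.
Qed.

Definition shift (k : int) (y : pathT) : pathT := fun j => y (j + k).

Lemma measurable_shift k : measurable_fun setT (shift k).
Proof. by apply: measurable_fun_path => n; exact: measurable_coord. Qed.

Lemma shiftD k l y : shift k (shift l y) = shift (k + l) y.
Proof. by apply/funext => j; rewrite /shift addrA. Qed.

Lemma shift0 y : shift 0 y = y.
Proof. by apply/funext => j; rewrite /shift addr0. Qed.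

(** Overwriting the coordinates in [s] forgets them: preimages under [zero_on s] are events
    determined by the other coordinates, which avoids restricting paths to a sub-index set. *)
Definition zero_on (s : seq int) (y : pathT) : pathT :=
  fun i => if i \in s then 0 else y i.

Lemma measurable_zero_on s : measurable_fun setT (zero_on s).
Proof.
apply: measurable_fun_path => n; rewrite /zero_on; case: (n \in s) => //.
exact: measurable_coord.
Qed.

Definition independent_coordinates (m : probability pathT R) :=
  forall s B, uniq s -> (forall i, measurable (B i)) ->
  m (cylinder s B) = (\prod_(i <- s) m ((fun y : pathT => y i) @^-1` B i))%E.

(** As functions of [D] both sides are finite measures, so it suffices to compare them on cylinders,
    where independence of the coordinates applies. *)
Lemma independent_zero_on (m : probability pathT R) s B D :
  independent_coordinates m -> uniq s -> (forall i, measurable (B i)) ->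
  measurable D ->
  m (cylinder s B `&` zero_on s @^-1` D) =
  (m (cylinder s B) * m (zero_on s @^-1` D))%E.
Proof.
move=> mind us mB mD.
have mC := measurable_cylinder s mB.
pose m1 := image_measure (mrestr m mC) (measurable_zero_on s).
have c0 : 0 <= fine (m (cylinder s B)) by exact: fine_ge0.
pose m2 : {measure set pathT -> \bar R} :=
  mscale (NngNum c0) (image_measure m (measurable_zero_on s)).
rewrite setIC.
transitivity (m1 D) => //.
have m2E X : m2 X = (m (cylinder s B) * m (zero_on s @^-1` X))%E.
  by rewrite /m2 /= /mscale/= fineK// fin_num_measure.
rewrite -m2E.
apply: path_measure_unique => // {D mD}.
  rewrite /m1 /= /pushforward/= /mrestr preimage_setT setTI.
  by rewrite (le_lt_trans (probability_le1 m mC)) ?ltry.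
move=> s' B' us' mB'.
rewrite m2E /m1 /= /pushforward/= /mrestr.
(* At an index of [s] the zeroed path is deterministic: the constraint only asks whether 0 lies in
   [B' i]. If one such constraint fails, the preimage is empty. *)
have [B0|nB0] := pselect (forall i, i \in s -> i \in s' -> B' i 0); last first.
  rewrite (_ : zero_on s @^-1` _ = set0) ?set0I ?measure0 ?mule0//.
  apply/seteqP; split=> // y /= h; apply: nB0 => i is_ is'.
  by have := h i is'; rewrite /zero_on is_.
pose s1 := [seq i <- s' | i \notin s].
have us1 : uniq s1 by rewrite filter_uniq.
have -> : zero_on s @^-1` cylinder s' B' = cylinder s1 B'.
  apply/seteqP; split=> y /= h i.
    by rewrite mem_filter => /andP[/negbTE ins is']; have := h i is';
      rewrite /zero_on ins.
  move=> is'; rewrite /zero_on; case: ifPn => ins; first exact: B0.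
  by apply: h; rewrite mem_filter ins.
(* The index lists [s] and [s1] are disjoint, so the two cylinders merge into a single one. *)
pose B1 i := if i \in s then B i else B' i.
have -> : cylinder s1 B' `&` cylinder s B = cylinder (s ++ s1) B1.
  apply/seteqP; split=> y /=.
    move=> [h1 h2] i; rewrite mem_cat /B1 mem_filter; case: ifPn => /= ins.
      by move=> _; exact: h2.
    by move=> is'; apply: h1; rewrite mem_filter ins.
  move=> h; split=> i.
    rewrite mem_filter => /andP[ins is'].
    by have := h i; rewrite mem_cat mem_filter /B1 (negbTE ins) is'; apply.
  by move=> ins; have := h i; rewrite mem_cat /B1 ins; apply.
have us2 : uniq (s ++ s1).
  rewrite cat_uniq us us1 andbT/= -all_predC; apply/allP => i.
  by rewrite mem_filter => /andP[].
rewrite mind// => [|i]; last by rewrite /B1; case: ifP.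
rewrite big_cat/= !mind//; congr (_ * _)%E.
  by apply: eq_big_seq => i ins; rewrite /B1 ins.
by apply: eq_big_seq => i; rewrite mem_filter /B1 => /andP[/negbTE ->].
Qed.

(* An event untouched by finite changes is independent of every cylinder, hence
   of itself. *)
Lemma kolmogorov_zero_one (m : probability pathT R) (A : set pathT) :
  independent_coordinates m -> measurable A ->
  (forall s, zero_on s @^-1` A = A) -> m A = 0%E \/ m A = 1%E.
Proof.
move=> mind mA tailA.
have c0 : 0 <= fine (m A) by exact: fine_ge0.
have mAfin : m A \is a fin_num by rewrite fin_num_measure.
have indA : m A = (m A * m A)%E.
  transitivity (mrestr m mA A); first by rewrite /mrestr setIid.
  transitivity (mscale (NngNum c0) m A); last by rewrite /mscale/= fineK.
  apply: path_measure_unique => //.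
    by rewrite /= /mrestr setTI (le_lt_trans (probability_le1 m mA)) ?ltry.
  move=> s B us mB; rewrite /= /mrestr /mscale/= fineK//.
  by rewrite -[in LHS](tailA s) independent_zero_on// (tailA s) muleC.
move: indA; rewrite -(fineK mAfin) -EFinM; move: (fine (m A)) => a aa.
have a2 : a = a * a by exact: EFin_inj aa.
have : a * (1 - a) == 0 by rewrite mulrBr mulr1 -a2 subrr.
rewrite mulf_eq0 subr_eq0 => /predU1P[->|/eqP <-]; first by left.
by right.
Qed.

End path_space.
Notation pathT R := (g_sigma_algebraType (@coordinate_sets R)).

(** * Averages along a measure-preserving map *)

Section bounded_integrals.
Context d (T : measurableType d) (R : realType) (P : probability T R).

Lemma integrable_bounded (f : T -> R) (b : R) :
  measurable_fun [set: T] f -> (forall x, `|f x| <= b) ->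
  P.-integrable [set: T] (EFin \o f).
Proof.
move=> mf fb; apply: measurable_bounded_integrable => //.
  by rewrite (le_lt_trans (probability_le1 P measurableT)) ?ltry.
exists b; split; first exact: num_real.
by move=> x bx y _ /=; rewrite (le_trans (fb y))// ltW.
Qed.

Lemma integrable_constant (c : R) :
  P.-integrable [set: T] (EFin \o (fun=> c)).
Proof. by apply: (@integrable_bounded _ `|c|). Qed.

Lemma Rintegral_cvg_bounded (f_ : nat -> T -> R) (f : T -> R) (b : R) :
  (forall n, measurable_fun [set: T] (f_ n)) -> measurable_fun [set: T] f ->
  (forall n x, `|f_ n x| <= b) ->
  {ae P, forall x, f_ n x @[n --> \oo] --> f x} ->
  \int[P]_x f_ n x @[n --> \oo] --> \int[P]_x f x.
Proof.
move=> mf_ mf f_b f_f.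
have [] := @dominated_convergence _ T R P setT measurableT
  (fun n => EFin \o f_ n) (EFin \o f) (cst b%:E).
- by move=> n; exact/measurable_EFinP.
- exact/measurable_EFinP.
- apply: filterS f_f => x fx _; apply: cvg_EFin => //.
  by apply: nearW => n.
- by apply: integrable_bounded => // x; rewrite ler_norm.
- by apply: nearW => x n _; rewrite lee_fin.
move=> intf _ h; apply: fine_cvg.
rewrite fineK; first exact: h.
exact: integrable_fin_num.
Qed.

Lemma Rintegral_probability_cst (c : R) : \int[P]_x c = c.
Proof.
rewrite Rintegral_cst// [X in fine X](_ : _ = 1%E) ?mulr1//.
exact: probability_setT.
Qed.

Lemma bounded_sum (f : nat -> T -> R) (b : R) n x :
  (forall i x, `|f i x| <= b) -> `|\sum_(0 <= i < n) f i x| <= n%:R * b.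
Proof.
move=> fb; rewrite (le_trans (ler_norm_sum _ _ _))//.
rewrite (le_trans (ler_sum _ (fun i _ => fb i x)))//.
by rewrite sumr_const_nat subn0 mulr_natl.
Qed.

Lemma Rintegral_sum (f : nat -> T -> R) (b : R) n :
  (forall i, measurable_fun [set: T] (f i)) -> (forall i x, `|f i x| <= b) ->
  \int[P]_x (\sum_(0 <= i < n) f i x) = \sum_(0 <= i < n) \int[P]_x f i x.
Proof.
move=> mf fb; elim: n => [|n IH].
  under eq_Rintegral do rewrite big_geq//.
  by rewrite Rintegral_probability_cst big_geq.
under eq_Rintegral do rewrite big_nat_recr//=.
rewrite RintegralD//; last exact: integrable_bounded (mf n) (fb n).
  by rewrite IH big_nat_recr.
apply: (@integrable_bounded _ (n%:R * b)); first exact: measurable_sum.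
by move=> x; exact: bounded_sum.
Qed.

End bounded_integrals.

Definition unbounded_sums (R : realType) (u : nat -> R) :=
  forall K : nat, exists n, K%:R < \sum_(0 <= i < n) u i.

(** Dropping the first term moves every partial sum by [u 0]; raising the threshold by an integer
    above [|u 0|] absorbs this. It makes the event of unbounded sums along an orbit
    shift-invariant. *)
Lemma unbounded_sums_shift (R : realType) (u : nat -> R) :
  unbounded_sums (fun i => u i.+1) <-> unbounded_sums u.
Proof.
split=> h K.
  have [m Km] := h (K + Num.bound `|u 0%N|)%N.
  exists m.+1; rewrite big_nat_recl//; move: Km; rewrite natrD -ltrBrDr.
  move/lt_le_trans; apply; rewrite addrC lerD2r lerNl.
  by rewrite (le_trans (ler_norm _))// normrN ltW// archi_boundP.
have [[|m]] := h (K + Num.bound `|u 0%N|)%N.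
  by rewrite big_geq// ltNge ler0n.
rewrite big_nat_recl// => Km; exists m; rewrite -(ltrD2l (u 0%N)).
apply: le_lt_trans Km; rewrite natrD addrC lerD2l.
by rewrite (le_trans (ler_norm _))// ltW// archi_boundP.
Qed.

(** Used to see that changing finitely many inter-arrival times does not affect unboundedness. *)
Lemma unbounded_sums_eq_tail (R : realType) (u v : nat -> R) (k : nat) :
  (forall i, (k <= i)%N -> u i = v i) -> unbounded_sums u -> unbounded_sums v.
Proof.
elim: k u v => [|k IH] u v uv hu.
  by have -> : v = u by apply/funext => i; rewrite uv.
apply/unbounded_sums_shift; apply: (IH (fun i => u i.+1)).
  by move=> i ki; rewrite uv.
exact/unbounded_sums_shift.
Qed.

Lemma measurable_unbounded_sums d (T : measurableType d) (R : realType)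
    (h : nat -> T -> R) : (forall i, measurable_fun [set: T] (h i)) ->
  measurable [set w | unbounded_sums (h ^~ w)].
Proof.
move=> mh.
rewrite (_ : [set _ | _] = \bigcap_(K : nat) \bigcup_(n : nat)
  (fun w => \sum_(0 <= i < n) h i w) @^-1` `]K%:R, +oo[%classic); last first.
  apply/seteqP; split=> w /=.
    by move=> hw K _; have [n Kn] := hw K; exists n => //=; rewrite in_itv/= Kn.
  by move=> hw K; have [n _] := hw K I; rewrite /= in_itv/= andbT => ?; exists n.
apply: bigcapT_measurable => K; apply: bigcupT_measurable => n.
rewrite -[X in measurable X]setTI; apply: (measurable_sum _ mh) => //.
Qed.

(** * The maximal ergodic lemma and convergence of averages in L^1 *)

Section birkhoff.
Context d (T : measurableType d) (R : realType) (Q : probability T R).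
Variable th : T -> T.
Hypothesis mth : measurable_fun [set: T] th.
Hypothesis th_inv : forall A, measurable A -> Q (th @^-1` A) = Q A.

Lemma measurable_iter i : measurable_fun [set: T] (iter i th).
Proof.
by elim: i => [|i IH]; [exact: measurable_id|exact: measurableT_comp].
Qed.

Lemma Rintegral_inv (f : T -> R) (b : R) : measurable_fun [set: T] f ->
  (forall x, `|f x| <= b) -> \int[Q]_x f (th x) = \int[Q]_x f x.
Proof.
move=> mf fb; congr fine.
rewrite -(@integral_pushforward _ _ _ _ _ _ mth Q setT (EFin \o f))//.
- by apply: eq_measure_integral => A mA _; exact: th_inv.
- exact/measurable_EFinP.
- rewrite preimage_setT; apply: (@integrable_bounded _ _ _ _ _ b) => //.
  exact: measurableT_comp.
Qed.

Lemma Rintegral_inv_iter (f : T -> R) (b : R) i : measurable_fun [set: T] f ->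
  (forall x, `|f x| <= b) -> \int[Q]_x f (iter i th x) = \int[Q]_x f x.
Proof.
move=> mf fb; elim: i => // i IH; rewrite -IH.
rewrite -(@Rintegral_inv (f \o iter i th) b)//.
- by apply: eq_Rintegral => x _; rewrite /= -iterS iterSr.
- by apply: measurableT_comp => //; exact: measurable_iter.
- by move=> x; exact: fb.
Qed.

(** The maximum of the partial sums of [g] of lengths 0 to [n] along the orbit of [w]. Peeling off
    the first term gives the recursion that the maximal lemma exploits. *)
Fixpoint max_sums (g : T -> R) n (w : T) : R :=
  if n is m.+1 then Num.max 0 (g w + max_sums g m (th w)) else 0.

Lemma max_sums_ge0 g n w : 0 <= max_sums g n w.
Proof. by case: n => //= n; rewrite le_max lexx. Qed.

Lemma max_sums_le g n w : max_sums g n w <= max_sums g n.+1 w.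
Proof.
elim: n w => [|n IH] w; first exact: max_sums_ge0.
by rewrite /= le_max2// lerD2l; exact: IH.
Qed.

Lemma sum_le_max_sums g n k w : (k <= n)%N ->
  \sum_(0 <= i < k) g (iter i th w) <= max_sums g n w.
Proof.
elim: n k w => [|n IH] [|k] w //= kn.
- by rewrite big_geq.
- by rewrite big_geq// le_max lexx.
 rewrite big_nat_recl//= le_max lerD2l; apply/orP; right.
by under eq_bigr do rewrite -iterS iterSr; exact: IH.
Qed.

Lemma measurable_max_sums (g : T -> R) n : measurable_fun [set: T] g ->
  measurable_fun [set: T] (max_sums g n).
Proof.
move=> mg; elim: n => [|n IH] /=; first exact: measurable_cst.
apply: measurable_maxr => //; apply: measurable_funD => //.
exact: measurableT_comp.
Qed.

Lemma max_sums_bounded g b n w : 0 <= b -> (forall x, `|g x| <= b) ->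
  `|max_sums g n w| <= n%:R * b.
Proof.
move=> b0 gb; rewrite ger0_norm ?max_sums_ge0//.
elim: n w => [|n IH] w /=; first by rewrite mul0r.
rewrite ge_max mulr_ge0//= -natr1 mulrDl mul1r addrC lerD//.
by rewrite (le_trans (ler_norm _)).
Qed.

(* With [M = max_sums], [M_(n+1) - M_n \o th = max(g, - M_n \o th)] has a
   nonnegative integral and decreases to [g] where the sums are unbounded. *)
Lemma maximal_ergodic (g : T -> R) (b : R) : measurable_fun [set: T] g ->
  (forall x, `|g x| <= b) ->
  {ae Q, forall w, unbounded_sums (fun i => g (iter i th w))} ->
  0 <= \int[Q]_x g x.
Proof.
move=> mg gb aeB.
have b0 : 0 <= b by rewrite (le_trans (normr_ge0 (g point))).
pose M := max_sums g.
pose D n w := Num.max (g w) (- M n (th w)).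
have mM n : measurable_fun setT (M n) by exact: measurable_max_sums.
have mMth n : measurable_fun setT (fun w => M n (th w)).
  exact: measurableT_comp.
have mD n : measurable_fun setT (D n).
  by apply: measurable_maxr => //; exact: measurableT_comp.
have Db n w : `|D n w| <= b.
  rewrite ler_norml /D ge_max le_max; have := gb w; rewrite ler_norml.
  move=> /andP[-> ->] /=; rewrite lerNl (le_trans _ (max_sums_ge0 _ _ _))//.
  by rewrite oppr_le0.
have intD n : 0 <= \int[Q]_x D n x.
  have -> : \int[Q]_x D n x = \int[Q]_x (M n.+1 x - M n (th x)).
    apply: eq_Rintegral => x _; rewrite /D /M/=.
    by rewrite addr_maxl sub0r addrK maxC.
  rewrite RintegralB//; last 2 first.
  - exact: (integrable_bounded _ (mM n.+1) (fun x => max_sums_bounded _ x b0 gb)).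
  - apply: (integrable_bounded _ (mMth n)) => x.
    exact: (max_sums_bounded n (th x) b0 gb).
  rewrite (@Rintegral_inv _ (n%:R * b))//; last first.
    by move=> x; exact: max_sums_bounded.
  rewrite subr_ge0; apply: le_Rintegral => //.
  - exact: (integrable_bounded _ (mM n) (fun x => max_sums_bounded n x b0 gb)).
  - exact: (integrable_bounded _ (mM n.+1) (fun x => max_sums_bounded _ x b0 gb)).
  - by move=> x _; exact: max_sums_le.
have cvgD : \int[Q]_x D n x @[n --> \oo] --> \int[Q]_x g x.
  apply: (Rintegral_cvg_bounded mD mg Db).
  (* Once a partial sum started at [th w] exceeds [b], one has [- M n (th w) <= - b <= g w], hence
     [D n w = g w]. *)
  apply: filterS aeB => w /(iffRL (unbounded_sums_shift _)) /(_ (Num.bound b))[k kb].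
  apply: cvg_near_cst; exists k => // n /= kn; rewrite /D.
  apply/max_idPl.
  rewrite (@le_trans _ _ (- b))//; last by have := gb w; rewrite ler_norml => /andP[].
  rewrite lerN2 (le_trans (ltW (archi_boundP b0)))// (le_trans (ltW kb))//.
  by under eq_bigr do rewrite iterSr; exact: sum_le_max_sums.
rewrite -(cvg_lim _ cvgD)//; apply: limr_ge; first exact: (cvgP _ cvgD).
exact: nearW.
Qed.

Definition ergodic_avg (f : T -> R) n w :=
  (\sum_(0 <= i < n) f (iter i th w)) / n%:R.

Lemma measurable_ergodic_avg (f : T -> R) n : measurable_fun [set: T] f ->
  measurable_fun [set: T] (ergodic_avg f n).
Proof.
move=> mf; apply: measurable_funM => //; apply: measurable_sum => i.
by apply: measurableT_comp => //; exact: measurable_iter.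
Qed.

Lemma ergodic_avg_bounded (f : T -> R) (b : R) n w : 0 <= b -> (forall x, `|f x| <= b) ->
  `|ergodic_avg f n w| <= b.
Proof.
move=> b0 fb; rewrite /ergodic_avg normrM.
have [->|n0] := eqVneq n 0%N; first by rewrite big_geq// normr0 mul0r.
have n0' : 0 < n%:R :> R by rewrite ltr0n lt0n.
rewrite normfV (ger0_norm (ltW n0')) ler_pdivrMr// (le_trans (ler_norm_sum _ _ _))//.
rewrite (le_trans (ler_sum _ (fun i _ => fb (iter i th w))))//.
by rewrite sumr_const_nat subn0 mulr_natr.
Qed.

Lemma Rintegral_ergodic_avg (f : T -> R) (b : R) n : (0 < n)%N -> measurable_fun [set: T] f ->
  (forall x, `|f x| <= b) -> \int[Q]_x ergodic_avg f n x = \int[Q]_x f x.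
Proof.
move=> n0 mf fb.
have b0 : 0 <= b by rewrite (le_trans (normr_ge0 (f point))).
rewrite RintegralZr//; last first.
  apply: (@integrable_bounded _ _ _ _ _ (n%:R * b)).
    apply: measurable_sum => i.
    by apply: measurableT_comp => //; exact: measurable_iter.
  by move=> x; apply: (@bounded_sum _ _ _ (fun i x => f (iter i th x))).
rewrite (@Rintegral_sum _ _ _ _ (fun i x => f (iter i th x)) b)//; last first.
  by move=> i; apply: measurableT_comp => //; exact: measurable_iter.
under eq_bigr do rewrite (@Rintegral_inv_iter _ b)//.
rewrite sumr_const_nat subn0 -[X in X / _]mulr_natr mulfK//.
by rewrite pnatr_eq0 -lt0n.
Qed.

(** If the sums of [f - c] were almost surely unbounded, the maximal lemma would give a mean of [f]
    at least [c]. So they are almost surely bounded above by some [K], the positive part of the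
    average minus [c] is at most [K / n], and dominated convergence concludes. *)
Lemma ergodic_upper (f : T -> R) (b c : R) : measurable_fun [set: T] f ->
  (forall x, `|f x| <= b) -> \int[Q]_x f x < c ->
  (let B := [set w | unbounded_sums (fun i => f (iter i th w) - c)] in
   Q B = 0%E \/ Q B = 1%E) ->
  \int[Q]_x Num.max 0 (ergodic_avg f n x - c) @[n --> \oo] --> (0 : R).
Proof.
move=> mf fb fc /= B01; set B := [set w | _] in B01.
have b0 : 0 <= b by rewrite (le_trans (normr_ge0 (f point))).
have mB : measurable B.
  apply: measurable_unbounded_sums => i; apply: measurable_funB => //.
  by apply: measurableT_comp => //; exact: measurable_iter.
have QB : Q B = 0%E.
  case: B01 => // B1; exfalso.
  have : 0 <= \int[Q]_x (f x - c).
    apply: (@maximal_ergodic _ (b + `|c|)).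
    - exact: measurable_funB.
    - by move=> x; rewrite (le_trans (ler_normB _ _))// lerD2r.
    - exists (~` B); split => //; first exact: measurableC.
      by rewrite probability_setC// B1 subee.
  rewrite RintegralB// ?Rintegral_probability_cst//.
  - by rewrite subr_ge0 leNgt fc.
  - exact: integrable_bounded mf fb.
  - exact: integrable_constant.
pose h n x := Num.max 0 (ergodic_avg f n x - c).
have mh n : measurable_fun setT (h n).
  apply: measurable_maxr => //; apply: measurable_funB => //.
  exact: measurable_ergodic_avg.
have hb n x : `|h n x| <= b + `|c|.
  rewrite /h; set u := _ - c.
  have u0 : 0 <= Num.max 0 u by rewrite le_max lexx.
  rewrite (ger0_norm u0) ge_max addr_ge0//= /u.
  rewrite (le_trans (ler_norm _))// (le_trans (ler_normB _ _))// lerD2r.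
  exact: ergodic_avg_bounded.
rewrite -[X in _ --> X](Rintegral_probability_cst Q 0).
apply: (Rintegral_cvg_bounded mh _ hb) => //.
exists B; split => // w; apply: contra_notP => nBw.
have [K hK] : exists K : nat, forall n,
    \sum_(0 <= i < n) (f (iter i th w) - c) <= K%:R.
  apply: contrapT => /forallNP nK; apply: nBw => K.
  by have /existsNP[n /negP] := nK K; rewrite -ltNge => ?; exists n.
apply: (@squeeze_cvgr _ _ _ _ (cst 0) (fun n => K%:R * n%:R^-1)).
- near=> n; rewrite /h le_max lexx/= ge_max.
  have n0 : 0 < n%:R :> R by rewrite ltr0n; near: n; exists 1%N.
  rewrite mulr_ge0 ?invr_ge0 ?ler0n//=.
  rewrite /ergodic_avg -[c in X in X <= _](mulfK (lt0r_neq0 n0)) -mulrBl.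
  rewrite ler_wpM2r ?invr_ge0 ?ler0n//.
  rewrite (le_trans _ (hK n))// sumrB lerD2l lerN2.
  by rewrite sumr_const_nat subn0 mulr_natr.
- exact: cvg_cst.
- rewrite -[X in _ --> X](mulr0 K%:R); apply: cvgMr.
  by apply/gtr0_cvgV0; [near=> n; rewrite ltr0n; near: n; exists 1%N|exact: cvgr_idn].
Unshelve. all: by end_near.
Qed.

(** The upper bound alone suffices: the averages have mean exactly [e], so a small expected excess
    above [e] forces a small expected deficit. *)
Lemma ergodic_L1 (f : T -> R) (b : R) : measurable_fun [set: T] f ->
  (forall x, `|f x| <= b) ->
  (forall c, let B := [set w | unbounded_sums (fun i => f (iter i th w) - c)] in
   Q B = 0%E \/ Q B = 1%E) ->
  \int[Q]_x `|ergodic_avg f n x - \int[Q]_y f y| @[n --> \oo] --> (0 : R).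
Proof.
move=> mf fb B01; set e := \int[Q]_x f x.
have b0 : 0 <= b by rewrite (le_trans (normr_ge0 (f point))).
have mA n : measurable_fun setT (fun x => ergodic_avg f n x - e).
  by apply: measurable_funB => //; exact: measurable_ergodic_avg.
have Ab n x : `|ergodic_avg f n x - e| <= b + `|e|.
  by rewrite (le_trans (ler_normB _ _))// lerD2r ergodic_avg_bounded.
apply/cvgrPdist_le => eps eps0.
have d0 : 0 < eps / 4 by rewrite divr_gt0.
have ec : e < e + eps / 4 by rewrite ltrDl.
have /cvgrPdist_le /(_ _ d0) := ergodic_upper mf fb ec (B01 _).
move=> H; near=> n.
have n0 : (0 < n)%N by near: n; exists 1%N.
have H1 : \int[Q]_x Num.max 0 (ergodic_avg f n x - (e + eps / 4)) <= eps / 4.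
  have : `|0 - \int[Q]_x Num.max 0 (ergodic_avg f n x - (e + eps / 4))| <= eps / 4.
    by near: n; exact: H.
  by rewrite sub0r normrN => /(le_trans (ler_norm _)).
pose h x := Num.max 0 (ergodic_avg f n x - (e + eps / 4)).
have mh : measurable_fun setT h.
  apply: measurable_maxr => //; apply: measurable_funB => //.
  exact: measurable_ergodic_avg.
have hb x : `|h x| <= b + `|e + eps / 4|.
  rewrite /h; set u := _ - (e + eps / 4).
  have u0 : 0 <= Num.max 0 u by rewrite le_max lexx.
  rewrite (ger0_norm u0) ge_max addr_ge0//= /u.
  rewrite (le_trans (ler_norm _))// (le_trans (ler_normB _ _))// lerD2r.
  exact: ergodic_avg_bounded.
have iA : Q.-integrable setT (EFin \o (fun x => ergodic_avg f n x - e)).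
  exact: integrable_bounded (mA n) (Ab n).
have ih : Q.-integrable setT (EFin \o h) by exact: integrable_bounded mh hb.
have ih2 : Q.-integrable setT (EFin \o (fun x => 2 * h x)).
  apply: (@integrable_bounded _ _ _ _ _ (2 * (b + `|e + eps / 4|))).
    exact: measurable_funM.
  by move=> x; rewrite normrM ger0_norm// ler_pM2l.
have ic (c : R) : Q.-integrable setT (EFin \o (fun=> c)).
  exact: integrable_constant.
have ih3 : Q.-integrable setT (EFin \o (fun x => 2 * h x + eps / 2)).
  have := integrableD measurableT ih2 (ic (eps / 2)).
  by apply: eq_integrable => // x _.
rewrite sub0r normrN ger0_norm; last exact: Rintegral_ge0.
(* With [u] the centred average, [|u| <= 2 max(0, u - eps/4) + eps/2 - u], and [u] integrates to
   0. *)
apply: (@le_trans _ _ (\int[Q]_x (2 * h x + eps / 2 - (ergodic_avg f n x - e)))).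
  apply: le_Rintegral => //.
  - apply: (@integrable_bounded _ _ _ _ _ (b + `|e|)); last by move=> x; rewrite normr_id.
    exact: measurableT_comp.
  - by have := integrableB measurableT ih3 iA; apply: eq_integrable => // x _.
  - move=> x _; rewrite /h; set a := ergodic_avg f n x.
    have [ae|ae] := ger0P (a - e); have [|] := leP 0 (a - (e + eps / 4)) => ?; lra.
rewrite RintegralB// RintegralD// RintegralZl// Rintegral_probability_cst.
rewrite RintegralB//; last first.
  apply: (@integrable_bounded _ _ _ _ _ b).
    exact: measurable_ergodic_avg.
  by move=> x; exact: ergodic_avg_bounded.
rewrite (Rintegral_ergodic_avg n0 mf fb) Rintegral_probability_cst -/e subrr subr0.
rewrite /h; move: H1; lra.
Unshelve. all: by end_near.
Qed.
End birkhoff.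

(** * Independent inputs *)

Section independent_expectation.
Context d d1 d2 (T : measurableType d) (T1 : measurableType d1)
  (T2 : measurableType d2) (R : realType) (P : probability T R).
Variables (X : T -> T1) (Z : T -> T2).
Hypotheses (mX : measurable_fun [set: T] X) (mZ : measurable_fun [set: T] Z).
Hypothesis XZ : forall A B, measurable A -> measurable B ->
  P (X @^-1` A `&` Z @^-1` B) = (P (X @^-1` A) * P (Z @^-1` B))%E.

Let PX := image_probability P mX.
Let PZ := image_probability P mZ.
Let mXZ : measurable_fun [set: T] (fun t => (X t, Z t)).
Proof. exact/measurable_fun_pair. Qed.

Lemma independent_product_law A : measurable A ->
  (PX \x PZ)%E A = P ((fun t => (X t, Z t)) @^-1` A).
Proof.
move=> mA; rewrite -[RHS]/(image_measure P mXZ A).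
exact: product_measure_unique.
Qed.

(** The joint law is the product of the marginals, and Tonelli separates the integral. *)
Lemma independent_expectation (f : T1 -> \bar R) (g : T2 -> \bar R) :
  measurable_fun [set: T1] f -> measurable_fun [set: T2] g ->
  (forall x, 0 <= f x)%E -> (forall x, 0 <= g x)%E ->
  (\int[P]_t (f (X t) * g (Z t)) =
   (\int[P]_t f (X t)) * \int[P]_t g (Z t))%E.
Proof.
move=> mf mg f0 g0.
pose h (z : T1 * T2) := (f z.1 * g z.2)%E.
have mh : measurable_fun setT h.
  by apply: emeasurable_funM; exact: measurableT_comp.
have h0 z : (0 <= h z)%E by exact: mule_ge0.
transitivity (\int[(PX \x PZ)%E]_z h z)%E.
  transitivity (\int[pushforward P (fun t => (X t, Z t))]_z h z)%E.
    by rewrite ge0_integral_pushforward.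
  by apply: eq_measure_integral => A mA _; exact/esym/independent_product_law.
rewrite fubini_tonelli1// /fubini_F /h /=.
under eq_integral do rewrite ge0_integralZl//.
rewrite ge0_integralZr//; last exact: integral_ge0.
by rewrite !ge0_integral_pushforward.
Qed.

End independent_expectation.

(** * The product path space of service and inter-arrival times *)

Section joint_process.
Context (R : realType) (QY Qe : probability (pathT R) R).

Definition joint_shift (k : int) (w : pathT R * pathT R) :
    pathT R * pathT R :=
  (shift k w.1, shift k w.2).

Lemma measurable_joint_shift k : measurable_fun setT (joint_shift k).
Proof.
apply/measurable_fun_pair; apply: measurableT_comp => //;
  exact: measurable_shift.
Qed.

Lemma joint_shiftD k l w : joint_shift k (joint_shift l w) = joint_shift (k + l) w.
Proof. by rewrite /joint_shift/= !shiftD. Qed.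

Lemma joint_shift0 w : joint_shift 0 w = w.
Proof. by case: w => y e; rewrite /joint_shift/= !shift0. Qed.

Lemma iter_joint_shift i w : iter i (joint_shift 1) w = joint_shift i%:Z w.
Proof.
elim: i => [|i IH]; first by rewrite joint_shift0.
by rewrite iterS IH joint_shiftD -add1n PoszD.
Qed.

Hypothesis QY_inv : forall k A, measurable A -> QY (shift k @^-1` A) = QY A.
Hypothesis Qe_inv : forall k A, measurable A -> Qe (shift k @^-1` A) = Qe A.

Notation Q := (QY \x Qe)%E.

Lemma joint_inv k A : measurable A -> Q (joint_shift k @^-1` A) = Q A.
Proof.
move=> mA; rewrite -[LHS]/(image_measure Q (measurable_joint_shift k) A).
apply/esym; apply: product_measure_unique => // B C mB mC.
rewrite /= /pushforward (_ : _ @^-1` _ = (shift k @^-1` B) `*` (shift k @^-1` C))//.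
rewrite product_measure1E//; last 2 first.
- by rewrite -[X in measurable X]setTI; exact: measurable_shift.
- by rewrite -[X in measurable X]setTI; exact: measurable_shift.
by congr (_ * _)%E; [exact: QY_inv|exact: Qe_inv].
Qed.

Hypothesis Qe_ind : independent_coordinates Qe.
Hypothesis QY_erg : forall A, measurable A -> shift 1 @^-1` A = A ->
  QY A = 0%E \/ QY A = 1%E.

(** For fixed [y] the section of [B] is a tail event in [e], so its probability [phi y] is 0 or 1.
    The set [U] where it is 1 is shift-invariant, hence trivial by ergodicity, and Fubini identifies
    its probability with that of [B]. *)
Lemma joint_zero_one (B : set (pathT R * pathT R)) : measurable B ->
  joint_shift 1 @^-1` B = B ->
  (forall s y e, B (y, zero_on s e) <-> B (y, e)) ->
  Q B = 0%E \/ Q B = 1%E.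
Proof.
move=> mB Binv Btail.
pose phi y := Qe (xsection B y).
have mphi : measurable_fun setT phi by exact: measurable_fun_xsection.
have phi01 y : phi y = 0%E \/ phi y = 1%E.
  apply: kolmogorov_zero_one => //; first exact: measurable_xsection.
  move=> s; apply/seteqP; split=> e; rewrite /xsection/= !inE => h;
    exact/(Btail s y e).
pose U := [set y | phi y = 1%E].
have mU : measurable U.
  have := mphi measurableT [set 1%E] (emeasurable_set1 _).
  by rewrite setTI.
have phiU y : phi y = (\1_U y)%:E.
  rewrite indicE; case: (phi01 y) => phiy.
    rewrite memNset ?phiy// /U/= phiy => /eqP.
    by rewrite eq_sym onee_eq0.
  by rewrite mem_set ?phiy.
(* By invariance of [B], shifting [e] carries the section at [y] to the section at [shift 1 y], and
   [Qe] is shift-invariant. *)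
have phi_inv y : phi (shift 1 y) = phi y.
  rewrite /phi -(Qe_inv 1); last exact: measurable_xsection.
  congr (Qe _); apply/seteqP; split=> e; rewrite /xsection/= !inE => h.
    by rewrite -Binv.
  by rewrite -Binv in h.
have QBU : Q B = QY U.
  rewrite /product_measure1 -[RHS]mul1e -[RHS]/(1%:E * QY U)%E.
  under eq_integral do rewrite /= -/(phi _) phiU.
  by rewrite integral_indic// setIT mul1e.
rewrite QBU; apply: QY_erg => //.
by apply/seteqP; split => y; rewrite /U/= phi_inv.
Qed.

End joint_process.

(** * Lindley's recursion *)

Section coupling.
Context d (T : measurableType d) (R : realType) (P : probability T R).
Variables (X X' : T -> R) (N : set T) (q : R).
Hypotheses (mX : measurable_fun [set: T] X) (mX' : measurable_fun [set: T] X').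
Hypotheses (mN : measurable N) (XN : forall t, ~ N t -> X t = X' t).
Hypothesis PN : (P N <= q%:E)%E.

Lemma coupling_le A : measurable A -> (P (X @^-1` A) <= P (X' @^-1` A) + q%:E)%E.
Proof.
move=> mA.
have mXA : measurable (X @^-1` A) by rewrite -[X in measurable X]setTI; exact: mX.
have mXA' : measurable (X' @^-1` A) by rewrite -[X in measurable X]setTI; exact: mX'.
apply: (@le_trans _ _ (P (X' @^-1` A `|` N))).
  apply: le_measure; rewrite ?inE//; first exact: measurableU.
  move=> t /= At; have [|nN] := pselect (N t); first by right.
  by left; rewrite -XN.
rewrite (le_trans (measureU2 _ _ _))//; exact: leeD2l.
Qed.

(** The integrand vanishes off [N] and is at most [2 * b] on it. *)
Lemma coupling_expectation (Phi : R -> R) (b : R) :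
  measurable_fun [set: R] Phi -> (forall x, `|Phi x| <= b) ->
  \int[P]_t `|Phi (X t) - Phi (X' t)| <= 2 * b * q.
Proof.
move=> mPhi Phib.
have b0 : 0 <= b by rewrite (le_trans (normr_ge0 (Phi 0))).
have m1 : measurable_fun setT (fun t => `|Phi (X t) - Phi (X' t)|).
  apply: measurableT_comp => //.
  by apply: measurable_funB; exact: measurableT_comp.
have i1 : P.-integrable setT (EFin \o (fun t => `|Phi (X t) - Phi (X' t)|)).
  apply: (integrable_bounded _ m1 (b := b + b)) => x.
  by rewrite normr_id (le_trans (ler_normB _ _))// lerD.
have iN : P.-integrable setT (EFin \o (\1_N : T -> R)).
  apply: (@integrable_bounded _ _ _ _ _ 1) => // x.
  by rewrite ger0_norm// indicE; case: (x \in N).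
have i2 : P.-integrable setT (EFin \o (fun t => 2 * b * \1_N t)).
  apply: (@integrable_bounded _ _ _ _ _ (2 * b)).
    exact: measurable_funM.
  by move=> x; rewrite ger0_norm ?mulr_ge0// ler_piMr ?mulr_ge0// indicE;
    case: (x \in N).
apply: (@le_trans _ _ (\int[P]_t (2 * b * \1_N t))).
  apply: le_Rintegral => // t _; rewrite indicE.
  have [tN|] := boolP (t \in N).
    by rewrite mulr1 (le_trans (ler_normB _ _))// mulr_natl mulr2n lerD.
  by rewrite notin_setE => /XN ->; rewrite subrr normr0 mulr0.
rewrite RintegralZl// ler_wpM2l ?mulr_ge0//.
rewrite /Rintegral integral_indic// setIT -lee_fin fineK//.
by rewrite fin_num_measure.
Qed.

End coupling.

(** * Waiting times as functions of the input path *)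

Section lindley.
Context (R : realType).
Notation path2 := (pathT R * pathT R)%type.
Implicit Types (w : R) (z : path2).

Fixpoint lindley (w : R) (n : nat) (z : path2) : R :=
  if n is m.+1 then Num.max (lindley w m z + z.1 m%:Z - z.2 m.+1%:Z) 0 else w.

Definition walk (n : nat) (z : path2) : R :=
  \sum_(0 <= i < n) (z.1 i%:Z - z.2 i.+1%:Z).

Lemma measurable_fst_coord j : measurable_fun [set: path2] (fun z => z.1 j).
Proof. exact: (measurableT_comp (measurable_coord j) measurable_fst). Qed.

Lemma measurable_snd_coord j : measurable_fun [set: path2] (fun z => z.2 j).
Proof. exact: (measurableT_comp (measurable_coord j) measurable_snd). Qed.

Lemma measurable_lindley w n : measurable_fun [set: path2] (lindley w n).
Proof.
elim: n => [|n IH] /=; first exact: measurable_cst.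
apply: measurable_maxr => //; apply: measurable_funB.
  by apply: measurable_funD => //; exact: measurable_fst_coord.
exact: measurable_snd_coord.
Qed.

Lemma measurable_walk n : measurable_fun [set: path2] (walk n).
Proof.
apply: measurable_sum => i; apply: measurable_funB.
  exact: measurable_fst_coord.
exact: measurable_snd_coord.
Qed.

Lemma lindley_ge0 w n z : 0 <= w -> 0 <= lindley w n z.
Proof. by case: n => //= n _; rewrite le_max lexx orbT. Qed.

(** Adding an increment distributes over the maximum, and the truncation at 0 is absorbed by the
    queue started empty. Thus the initial load is forgotten as soon as [w + walk n z] is
    nonpositive. *)
Lemma lindley_max w n z : 0 <= w ->
  lindley w n z = Num.max (lindley 0 n z) (w + walk n z).
Proof.
move=> w0; elim: n => [|n IH].
  by rewrite /= /walk big_geq// addr0; apply/esym/max_idPr.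
rewrite /= IH /walk big_nat_recr//= -/(walk n z) -!addrA addr_maxl.
by rewrite -maxA (maxC _ 0) maxA !addrA.
Qed.

(** The recursion peels off the last step; this form peels off the first, as needed to compare
    queues started at times [-(m+1)] and [-m]. *)
Lemma lindley_step_left w n z :
  lindley w n.+1 z = lindley (lindley w 1 z) n (joint_shift 1 z).
Proof.
elim: n => [//|n IH]; rewrite [LHS]/= -/(lindley w n.+1 z) IH /=.
by rewrite /joint_shift /shift/= -!PoszD !addn1.
Qed.

Lemma walk_step_left n z : walk n.+1 z = (z.1 0 - z.2 1) + walk n (joint_shift 1 z).
Proof.
rewrite /walk big_nat_recl//; congr (_ + _).
by apply: eq_bigr => i _; rewrite /joint_shift /shift/= -!PoszD !addn1.
Qed.

Lemma lindley_ext w n z z' :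
  (forall i, (i < n)%N -> z.1 i%:Z = z'.1 i%:Z /\ z.2 i.+1%:Z = z'.2 i.+1%:Z) ->
  lindley w n z = lindley w n z'.
Proof.
elim: n => //= n IH h; have [-> ->] := h n (ltnSn n).
by rewrite IH// => i /ltnW ?; exact: h.
Qed.

Lemma lindley_coalesce w n z : 0 <= w -> ~ (0 < w + walk n z) ->
  lindley w n z = lindley 0 n z.
Proof.
move=> w0 /negP; rewrite -leNgt => h; rewrite lindley_max//.
by apply/max_idPl; rewrite (le_trans h)// lindley_ge0.
Qed.

(* The waiting time at time [0] of the queue started empty at time [-m]. *)
Definition backward (m : nat) (z : path2) : R :=
  lindley 0 m (joint_shift (- m%:Z) z).

Lemma measurable_backward m : measurable_fun [set: path2] (backward m).
Proof.
apply: measurableT_comp; first exact: measurable_lindley.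
exact: measurable_joint_shift.
Qed.

Lemma backward_ge0 m z : 0 <= backward m z.
Proof. exact: lindley_ge0. Qed.

Lemma lindley0E n z : lindley 0 n z = backward n (joint_shift n%:Z z).
Proof. by rewrite /backward joint_shiftD addNr joint_shift0. Qed.

(** Starting one step earlier amounts to starting at time [-m] with load [max(x, 0)], where [x] is
    the first increment. If [x <= 0] nothing changes; otherwise the load plus the remaining walk is
    the whole walk, which is nonpositive, so [lindley_max] discards it. *)
Lemma backward_stable m z : ~ (0 < walk m.+1 (joint_shift (- m.+1%:Z) z)) ->
  backward m.+1 z = backward m z.
Proof.
rewrite /backward; set z' := joint_shift (- m.+1%:Z) z.
have -> : joint_shift (- m%:Z) z = joint_shift 1 z'.
  by rewrite joint_shiftD; congr joint_shift; rewrite -addn1 PoszD; lia.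
rewrite walk_step_left lindley_step_left => nw.
rewrite lindley_max ?lindley_ge0//; apply/max_idPl => /=.
rewrite add0r; case: (leP (z'.1 0 - z'.2 1) 0) => x0.
  by rewrite add0r [leRHS]lindley_max// add0r le_max lexx orbT.
by move/negP : nw; rewrite -leNgt => /le_trans; apply; exact: lindley_ge0.
Qed.

End lindley.

(** * The stationary queue *)

(** On a Hahn decomposition the variation is the difference of the measures on the positive part
    plus the opposite difference on the negative part; each hypothesis bounds one of them by [c]. *)
Lemma d_TV_le (R : realType) (mu1 mu2 : probability R R) (c : R) :
  (forall A, measurable A -> mu1 A <= mu2 A + c%:E)%E ->
  (forall A, measurable A -> mu2 A <= mu1 A + c%:E)%E ->
  (d_TV mu1 mu2 <= (2 * c)%:E)%E.
Proof.
move=> h12 h21; rewrite /d_TV /total_variation_of.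
set nuPN := (X in charge_variation X); have [[mPos _] [mNeg _] _ _] := nuPN.
have mI : measurable (`[0, +oo[%classic : set R) by [].
have finite_mu (m : probability R R) A : measurable A -> m A \is a fin_num.
  by move=> mA; rewrite fin_num_measure.
rewrite /charge_variation /= jordan_posE jordan_negE cjordan_posE cjordan_negE.
rewrite /crestr0 mem_set//= /crestr /= /measure_diff /= /cadd /= /copp /=.
rewrite mulr_natl mulr2n EFinD; apply: leeD.
  rewrite leeBlDl ?finite_mu//; last exact: measurableI.
  by apply: h12; exact: measurableI.
rewrite oppeB; last by rewrite fin_num_adde_defr// finite_mu//; exact: measurableI.
rewrite addeC leeBlDl ?finite_mu//; last exact: measurableI.
by apply: h21; exact: measurableI.
Qed.

Section stationary_queue.
Context (R : realType).
Notation path2 := (pathT R * pathT R)%type.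
Variable Q : probability path2 R.
Hypothesis Q_inv : forall k A, measurable A -> Q (joint_shift k @^-1` A) = Q A.
Variables (alpha C r : R).
Hypotheses (C_ge0 : 0 <= C) (r_gt0 : 0 < r) (r_lt1 : r < 1).
Hypothesis tail : forall w n, 0 <= w ->
  (Q [set z | (0 < w + walk n z)%R] <= (expR (alpha * w) * C * r ^+ n)%:E)%E.

Definition unstable (k : nat) : set path2 :=
  [set z | 0 < walk k.+1 (joint_shift (- k.+1%:Z) z)].

Lemma measurable_walk_gt0 w n : measurable [set z : path2 | 0 < w + walk n z].
Proof.
have mw : measurable_fun setT (fun z : path2 => w + walk n z).
  by apply: measurable_funD => //; exact: measurable_walk.
rewrite (_ : [set _ | _] = (fun z : path2 => w + walk n z) @^-1` `]0, +oo[%classic).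
  by rewrite -[X in measurable X]setTI; exact: mw.
by apply/seteqP; split=> z /=; rewrite in_itv/= andbT.
Qed.

Lemma unstableE k : unstable k =
  joint_shift (- k.+1%:Z) @^-1` [set z : path2 | 0 < 0 + walk k.+1 z].
Proof. by apply/seteqP; split=> z; rewrite /unstable /= add0r. Qed.

Lemma measurable_unstable k : measurable (unstable k).
Proof.
rewrite unstableE -[X in measurable X]setTI.
by apply: measurable_joint_shift => //; exact: measurable_walk_gt0.
Qed.

Lemma unstable_le k : (Q (unstable k) <= (C * r ^+ k)%:E)%E.
Proof.
rewrite unstableE Q_inv; last exact: measurable_walk_gt0.
rewrite (le_trans (tail _ (lexx 0)))// mulr0 expR0 mul1r lee_fin.
by rewrite ler_wpM2l// exprS ler_piMl ?exprn_ge0// ltW.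
Qed.

(** Outside this event all queues started empty at time [-m] or earlier agree at time 0; a union
    bound over a geometric series estimates its probability. *)
Definition unstable_from (m : nat) := \bigcup_k unstable (m + k)%N.

Lemma measurable_unstable_from m : measurable (unstable_from m).
Proof. by apply: bigcupT_measurable => k; exact: measurable_unstable. Qed.

Lemma unstable_from_le m :
  (Q (unstable_from m) <= (C / (1 - r) * r ^+ m)%:E)%E.
Proof.
have := @measure_sigma_subadditive _ R _ Q (unstable_from m)
  (fun k => unstable (m + k)%N).
move=> /(_ _ _ (fun _ h => h))/le_trans; apply.
- by move=> k; exact: measurable_unstable.
- exact: measurable_unstable_from.
apply: lime_le; first exact: is_cvg_nneseries.
apply: nearW => n.
apply: (@le_trans _ _ (\sum_(0 <= k < n) (C * r ^+ m * r ^+ k)%:E)%E).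
  by apply: lee_sum => k _; rewrite (le_trans (unstable_le _))// exprD mulrA.
rewrite sumEFin lee_fin.
have Cr0 : 0 <= C * r ^+ m by rewrite mulr_ge0// exprn_ge0// ltW.
have := @geometric_le_lim R n _ _ Cr0 r_gt0.
rewrite ger0_norm; last exact: ltW.
by move=> /(_ r_lt1); rewrite mulrAC.
Qed.

Lemma backward_stable_from m z : ~ unstable_from m z ->
  forall k, backward (m + k) z = backward m z.
Proof.
move=> nz; elim=> [|k IH]; first by rewrite addn0.
rewrite addnS backward_stable// => h; apply: nz; exists k => //.
Qed.

(** The upper limit exists everywhere and is measurable. It can be infinite only on the null event
    where the sequence is never stable, and there [fine] returns 0. *)
Definition backward_lim (z : path2) : R :=
  fine (limn_esup (fun m => (backward m z)%:E)).

Lemma measurable_backward_lim : measurable_fun [set: path2] backward_lim.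
Proof.
apply: measurableT_comp => //.
apply: measurable_fun_limn_esup => n; apply/measurable_EFinP.
exact: measurable_backward.
Qed.

Lemma backward_limE m z : ~ unstable_from m z -> backward_lim z = backward m z.
Proof.
move=> nz; rewrite /backward_lim.
have : (fun m => (backward m z)%:E) @ \oo --> (backward m z)%:E.
  apply: cvg_near_cst; exists m => // n /= mn.
  by rewrite -(subnKC mn) backward_stable_from.
by move/cvg_limn_einf_sup => -[_ ->].
Qed.

Lemma backward_lim_ge0 z : 0 <= backward_lim z.
Proof.
apply: fine_ge0; rewrite limn_esup_lim; apply: lime_ge.
  exact: is_cvg_esups.
apply: nearW => n; apply: ereal_sup_ge.
by exists (backward n z)%:E; [exists n => /=|rewrite lee_fin backward_ge0].
Qed.

Definition stationary_law : probability R R :=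
  image_probability Q measurable_backward_lim.

Lemma stationary_law_nonneg : stationary_law `[0, +oo[%classic = 1%E.
Proof.
rewrite image_probabilityE (_ : _ @^-1` _ = setT) ?probability_setT//.
by apply/seteqP; split=> z //= _; rewrite in_itv/= andbT backward_lim_ge0.
Qed.

(** The two variables differ by a time shift of [n], which preserves [Q]. *)
Lemma lindley0_law n A : measurable A ->
  Q (lindley 0 n @^-1` A) = Q (backward n @^-1` A).
Proof.
move=> mA; rewrite -(Q_inv (- n%:Z))//.
by rewrite -[X in measurable X]setTI; exact: measurable_lindley.
Qed.

(** The first summand is the cost of replacing the initial load [w] by 0, the second that of
    replacing [backward n] by its limit. *)
Definition rate w := expR (alpha * w) * C + C / (1 - r).

Lemma lindley_law_upper w n A : 0 <= w -> measurable A ->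
  (Q (lindley w n @^-1` A) <= stationary_law A + (rate w * r ^+ n)%:E)%E.
Proof.
move=> w0 mA.
apply: le_trans (coupling_le (measurable_lindley w n) (measurable_lindley 0 n)
  (measurable_walk_gt0 w n) _ (tail n w0) mA) _.
  by move=> z; exact: lindley_coalesce.
rewrite lindley0_law// /rate mulrDl EFinD addeA addeAC leeD2r//.
apply: (coupling_le (measurable_backward n) measurable_backward_lim
  (measurable_unstable_from n) _ (unstable_from_le n) mA).
by move=> z /backward_limE ->.
Qed.

Lemma lindley_law_lower w n A : 0 <= w -> measurable A ->
  (stationary_law A <= Q (lindley w n @^-1` A) + (rate w * r ^+ n)%:E)%E.
Proof.
move=> w0 mA.
apply: le_trans (coupling_le measurable_backward_lim (measurable_backward n)
  (measurable_unstable_from n) _ (unstable_from_le n) mA) _.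
  by move=> z /backward_limE ->.
rewrite -lindley0_law// /rate mulrDl EFinD addeA leeD2r//.
apply: (coupling_le (measurable_lindley 0 n) (measurable_lindley w n)
  (measurable_walk_gt0 w n) _ (tail n w0) mA).
by move=> z /(lindley_coalesce w0) ->.
Qed.

Lemma rate_ge0 w : 0 <= rate w.
Proof. by rewrite addr_ge0 ?mulr_ge0 ?expR_ge0// invr_ge0 subr_ge0 ltW. Qed.

Lemma seq_upper_bound (s : seq int) : exists N : nat, forall x, x \in s -> x < N%:Z.
Proof.
elim: s => [|a s [N hN]]; first by exists 0%N.
exists (N + `|a|.+1)%N => x; rewrite inE => /predU1P[->|/hN]; lia.
Qed.

(** At time [i] the variable [backward m] reads only the coordinates [i - m + 1] to [i] of [e],
    which lie beyond [s] for large [i]. *)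
Lemma backward_zero_on m s : exists k : nat, forall i (y e : pathT R), (k <= i)%N ->
  backward m (joint_shift i%:Z (y, zero_on s e)) =
  backward m (joint_shift i%:Z (y, e)).
Proof.
have [N hN] := seq_upper_bound s.
exists (N + m)%N => i y e Ni; rewrite /backward !joint_shiftD.
apply: lindley_ext => j jm; split => //=; rewrite /shift /zero_on ifF//.
apply/negP => /hN; move: Ni jm; lia.
Qed.

Definition finite_change_invariant (B : set path2) :=
  forall s y e, B (y, zero_on s e) <-> B (y, e).

Hypothesis Q01 : forall B, measurable B -> joint_shift 1 @^-1` B = B ->
  finite_change_invariant B -> Q B = 0%E \/ Q B = 1%E.

Variables (Phi : R -> R) (b : R).
Hypotheses (mPhi : measurable_fun [set: R] Phi) (Phib : forall x, `|Phi x| <= b).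

Let th := @joint_shift R 1.

Let b_ge0 : 0 <= b. Proof. by rewrite (le_trans (normr_ge0 (Phi 0))). Qed.

Lemma backward_average_L1 m :
  \int[Q]_z `|ergodic_avg th (Phi \o backward m) n z
    - \int[Q]_x Phi (backward m x)| @[n --> \oo] --> (0 : R).
Proof.
have mF : measurable_fun setT (Phi \o backward m).
  by apply: measurableT_comp => //; exact: measurable_backward.
have mth : measurable_fun setT th by exact: measurable_joint_shift.
apply: (ergodic_L1 mth _ mF) => [A mA|x|c]; [exact: Q_inv|exact: Phib|].
apply: Q01.
- apply: measurable_unbounded_sums => i; apply: measurable_funB => //.
  by apply: measurableT_comp => //; exact: measurable_iter.
- apply/seteqP; split=> z /=.
    move=> h; apply/unbounded_sums_shift.
    by under [X in unbounded_sums X]eq_fun do rewrite iterSr.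
  move=> /(iffRL (unbounded_sums_shift _)).
  by under [X in unbounded_sums X]eq_fun do rewrite iterSr.
- move=> s y e; have [k hk] := backward_zero_on m s.
  split; apply: (@unbounded_sums_eq_tail _ _ _ k) => i ki /=;
    by rewrite !iter_joint_shift hk.
Qed.

Lemma backward_mean_dist m :
  `|\int[Q]_x Phi (backward m x) - \int[stationary_law]_x Phi x| <=
  2 * b * (C / (1 - r) * r ^+ m).
Proof.
have mF n : measurable_fun setT (Phi \o backward n).
  by apply: measurableT_comp => //; exact: measurable_backward.
have mG : measurable_fun setT (Phi \o backward_lim).
  by apply: measurableT_comp => //; exact: measurable_backward_lim.
have -> : \int[stationary_law]_x Phi x = \int[Q]_z Phi (backward_lim z).
  congr fine; rewrite (@integral_pushforward _ _ _ _ _ _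
    measurable_backward_lim Q setT (EFin \o Phi))//.
  - exact/measurable_EFinP.
  - by rewrite preimage_setT; apply: (integrable_bounded _ mG) => x; exact: Phib.
have iF : Q.-integrable setT (EFin \o (Phi \o backward m)).
  exact: (integrable_bounded Q (mF m) (fun x => Phib _)).
have iG : Q.-integrable setT (EFin \o (Phi \o backward_lim)).
  exact: (integrable_bounded Q mG (fun x => Phib _)).
rewrite -(RintegralB measurableT iF iG).
apply: le_trans (le_normr_Rintegral _ _) _ => //.
  apply: (@integrable_bounded _ _ _ _ _ (b + b)); first exact: measurable_funB.
  by move=> x; rewrite (le_trans (ler_normB _ _))// lerD//; exact: Phib.
apply: (coupling_expectation (measurable_backward m) measurable_backward_lim
  (measurable_unstable_from m) _ (unstable_from_le m) mPhi Phib).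
by move=> z /backward_limE ->.
Qed.

Lemma lindley_backward_dist w m i : 0 <= w ->
  \int[Q]_z `|Phi (lindley w i z) - Phi (backward m (iter i th z))| <=
  2 * b * (rate w * (r ^+ i + r ^+ m)).
Proof.
move=> w0.
have mU k : measurable (joint_shift i%:Z @^-1` unstable_from k).
  rewrite -[X in measurable X]setTI; apply: measurable_joint_shift => //.
  exact: measurable_unstable_from.
have QU k : (Q (joint_shift i%:Z @^-1` unstable_from k) <=
    (C / (1 - r) * r ^+ k)%:E)%E.
  by rewrite Q_inv ?unstable_from_le//; exact: measurable_unstable_from.
(* Off [N] the initial load is forgotten, and at time [i] both [backward i] and [backward m] equal
   [backward_lim], so they agree. *)
pose N := [set z : path2 | 0 < w + walk i z] `|`
  (joint_shift i%:Z @^-1` unstable_from i `|` joint_shift i%:Z @^-1` unstable_from m).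
have mN : measurable N.
  by apply: measurableU; [exact: measurable_walk_gt0|exact: measurableU].
have mZ : measurable_fun setT (fun z => backward m (iter i th z)).
  apply: measurableT_comp; first exact: measurable_backward.
  by apply: measurable_iter; exact: measurable_joint_shift.
apply: (coupling_expectation (measurable_lindley w i) mZ mN _ _ mPhi Phib).
  move=> z /not_orP[nw /not_orP[ni nm]]; rewrite iter_joint_shift.
  by rewrite lindley_coalesce// lindley0E -(backward_limE ni) (backward_limE nm).
apply: le_trans (measureU2 _ _ _) _ => //.
- exact: measurable_walk_gt0.
- exact: measurableU.
(* The first two events together cost exactly [rate w * r ^+ i]; the third costs at most
   [rate w * r ^+ m]. *)
rewrite mulrDr /rate 2!mulrDl !EFinD -!addeA.
apply: leeD; first exact: tail.
apply: le_trans (measureU2 _ _ _) _ => //.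
apply: leeD; first exact: QU.
apply: le_trans (QU m) _; rewrite -EFinD lee_fin lerDr.
by rewrite mulr_ge0 ?mulr_ge0 ?expR_ge0// exprn_ge0// ltW.
Qed.

Lemma queue_average_L1 w : 0 <= w ->
  \int[Q]_z `|(\sum_(0 <= i < n) Phi (lindley w i z)) / n%:R
    - \int[stationary_law]_x Phi x| @[n --> \oo] --> (0 : R).
Proof.
move=> w0; apply/cvgrPdist_le => eps eps0.
set I := \int[stationary_law]_x Phi x.
pose K := 2 * b * rate w.
have K0 : 0 <= K by rewrite !mulr_ge0// rate_ge0.
have e3 : 0 < eps / 4 by rewrite divr_gt0.
(* The truncation depth [m] is fixed first, with [K * r ^+ m <= eps / 4]; only then does [n] tend to
   infinity. *)
have /cvgrPdist_le /(_ _ e3)[m _ /(_ m (leqnn m))] :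
    geometric K r n @[n --> \oo] --> (0 : R).
  by apply: cvg_geometric; rewrite ger0_norm// ltW.
rewrite /= sub0r normrN ger0_norm => [Km|]; last by rewrite mulr_ge0// exprn_ge0// ltW.
have /cvgrPdist_le /(_ _ e3) HF := backward_average_L1 m.
have /cvgrPdist_le /(_ _ e3) HK : K / (1 - r) * n%:R^-1 @[n --> \oo] --> (0 : R).
  rewrite -[X in _ --> X](mulr0 (K / (1 - r))); apply: cvgMr.
  by apply/gtr0_cvgV0; [near=> n; rewrite ltr0n; near: n; exists 1%N|exact: cvgr_idn].
near=> n.
have n0 : 0 < n%:R :> R by rewrite ltr0n; near: n; exists 1%N.
set e := \int[Q]_x Phi (backward m x).
have H1 : \int[Q]_z `|ergodic_avg th (Phi \o backward m) n z - e| <= eps / 4.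
  have : `|0 - \int[Q]_z `|ergodic_avg th (Phi \o backward m) n z - e| | <= eps / 4.
    by near: n; exact: HF.
  by rewrite sub0r normrN => /(le_trans (ler_norm _)).
have H2 : K / (1 - r) / n%:R <= eps / 4.
  have : `|0 - K / (1 - r) / n%:R| <= eps / 4 by near: n; exact: HK.
  by rewrite sub0r normrN => /(le_trans (ler_norm _)).
pose g i z := `|Phi (lindley w i z) - Phi (backward m (iter i th z))|.
have mV i : measurable_fun setT (fun z => Phi (lindley w i z)).
  by apply: measurableT_comp => //; exact: measurable_lindley.
have mth : measurable_fun setT th by exact: measurable_joint_shift.
have mB : measurable_fun setT (Phi \o backward m).
  by apply: measurableT_comp => //; exact: measurable_backward.
have mg i : measurable_fun setT (g i).
  apply: measurableT_comp => //; apply: measurable_funB => //.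
  exact: measurableT_comp mB (measurable_iter mth i).
have gb i z : `|g i z| <= b + b.
  by rewrite normr_id (le_trans (ler_normB _ _))// lerD.
have ig : Q.-integrable setT (EFin \o (fun z => \sum_(0 <= i < n) g i z)).
  apply: (@integrable_bounded _ _ _ _ _ (n%:R * (b + b))).
    exact: measurable_sum.
  by move=> x; exact: bounded_sum.
have ign : Q.-integrable setT (EFin \o (fun z => (\sum_(0 <= i < n) g i z) / n%:R)).
  apply: (@integrable_bounded _ _ _ _ _ (n%:R * (b + b) / n%:R)).
    by apply: measurable_funM => //; exact: measurable_sum.
  by move=> x; rewrite normrM normfV (ger0_norm (ltW n0)) ler_pM2r ?invr_gt0// bounded_sum.
have ia : Q.-integrable setT
    (EFin \o (fun z => `|ergodic_avg th (Phi \o backward m) n z - e|)).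
  apply: (@integrable_bounded _ _ _ _ _ (b + `|e|)).
    apply: measurableT_comp => //; apply: measurable_funB => //.
    exact: measurable_ergodic_avg.
  move=> x; rewrite normr_id (le_trans (ler_normB _ _))// lerD2r.
  by apply: ergodic_avg_bounded => // y; exact: Phib.
have iD : Q.-integrable setT (EFin \o (fun z => (\sum_(0 <= i < n) g i z) / n%:R +
    `|ergodic_avg th (Phi \o backward m) n z - e|)).
  by have := integrableD measurableT ign ia; apply: eq_integrable => // x _.
rewrite sub0r normrN ger0_norm; last exact: Rintegral_ge0.
apply: (@le_trans _ _ (\int[Q]_z ((\sum_(0 <= i < n) g i z) / n%:R +
    `|ergodic_avg th (Phi \o backward m) n z - e| + `|e - I|))).
  apply: le_Rintegral => //.
  - apply: (@integrable_bounded _ _ _ _ _ (b + `|I|)).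
      apply: measurableT_comp => //; apply: measurable_funB => //.
      by apply: measurable_funM => //; exact: measurable_sum.
    move=> x; rewrite normr_id (le_trans (ler_normB _ _))// lerD2r.
    rewrite normrM normfV (ger0_norm (ltW n0)) ler_pdivrMr// mulrC.
    by apply: (@bounded_sum _ _ _ (fun i x => Phi (lindley w i x))).
  - by have := integrableD measurableT iD (integrable_constant Q `|e - I|);
      apply: eq_integrable => // x _.
  - move=> z _.
    rewrite (_ : _ - I = ((\sum_(0 <= i < n) Phi (lindley w i z)) / n%:R -
      ergodic_avg th (Phi \o backward m) n z) +
      (ergodic_avg th (Phi \o backward m) n z - e) + (e - I)); last by ring.
    rewrite (le_trans (ler_normD _ _))// lerD2r (le_trans (ler_normD _ _))// lerD2r.
    rewrite /ergodic_avg -mulrBl -sumrB normrM normfV (ger0_norm (ltW n0)).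
    by rewrite ler_wpM2r ?invr_ge0 ?(ltW n0)// ler_norm_sum.
rewrite (RintegralD measurableT iD (integrable_constant Q `|e - I|)).
rewrite Rintegral_probability_cst (RintegralD measurableT ign ia) RintegralZr//
  (Rintegral_sum _ _ mg gb).
(* The quarters pay, in order, for the averaged transient [K / (1 - r) / n], the truncation
   [K * r ^+ m], the L^1 error for [backward m], and the distance between the means [e] and [I]. *)
have -> : eps = (eps / 4 + eps / 4) + eps / 4 + eps / 4 by field.
apply: lerD; last first.
  rewrite (le_trans (backward_mean_dist m))// (le_trans _ Km)// /geometric/=.
  rewrite mulrA ler_wpM2r ?exprn_ge0 ?(ltW r_gt0)// /K ler_wpM2l ?mulr_ge0//.
  by rewrite /rate lerDr mulr_ge0// expR_ge0.
apply: lerD => //.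
apply: (@le_trans _ _ (K / (1 - r) / n%:R + K * r ^+ m)); last exact: lerD.
rewrite ler_pdivrMr// mulrDl divfK ?gt_eqF//.
apply: (@le_trans _ _ (\sum_(0 <= i < n) (K * r ^+ i + K * r ^+ m))).
  apply: ler_sum => i _; rewrite (le_trans (lindley_backward_dist m i w0))//.
  by rewrite /K mulrA mulrDr.
rewrite big_split/= sumr_const_nat subn0 mulr_natr lerD2r.
by apply: geometric_le_lim => //; rewrite ger0_norm// ltW.
Unshelve. all: by end_near.
Qed.

End stationary_queue.

(** * Exponential moments of the input *)

Section queue_input.
Context (d : measure_display) (T : measurableType d) (R : realType)
  (P : probability T R) (Y eps : int -> {RV P >-> R}).

Implicit Types (X : int -> {RV P >-> R}) (A : set (pathT R)).

Definition path_rv (X : int -> {RV P >-> R}) (t : T) : pathT R :=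
  path_of (fun n => X n : T -> R) t.

Lemma measurable_path_rv X : measurable_fun [set: T] (path_rv X).
Proof. by apply: measurable_fun_path => n; exact: measurable_funP. Qed.

Definition process_law X : probability (pathT R) R :=
  image_probability P (measurable_path_rv X).

Lemma process_law_cylinder X s (B : int -> set R) : iid P X -> uniq s ->
  (forall i, measurable (B i)) ->
  process_law X (cylinder s B) = (\prod_(i <- s) P (X i @^-1` B i))%E.
Proof.
move=> [Xind _] us mB; rewrite -Xind// image_probabilityE; congr (P _).
rewrite cylinderE; elim: s {us} => [|i s IH]; first by rewrite !big_nil preimage_setT.
by rewrite !big_cons preimage_setI IH.
Qed.

Lemma independent_coordinates_iid X : iid P X ->
  independent_coordinates (process_law X).
Proof. by move=> Xiid s B us mB; rewrite process_law_cylinder. Qed.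

Lemma process_law_shift_iid X k A : iid P X -> measurable A ->
  process_law X (shift k @^-1` A) = process_law X A.
Proof.
move=> Xiid.
pose m1 := image_measure (process_law X) (@measurable_shift R k).
apply: (@path_measure_unique R m1 (process_law X)) => //.
  rewrite /m1/= /pushforward preimage_setT.
  by rewrite (le_lt_trans (probability_le1 _ _)) ?ltry.
move=> s B us mB; rewrite /m1/= /pushforward.
have -> : shift k @^-1` cylinder s B =
    cylinder [seq j + k | j <- s] (fun i => B (i - k)).
  apply/seteqP; split=> y h i.
    by move=> /mapP[j js ->]; rewrite addrK; exact: h.
  by move=> is_; have := h _ (map_f (fun j => j + k) is_); rewrite addrK.
rewrite !process_law_cylinder//; last by rewrite map_inj_uniq//; exact: addIr.
rewrite big_map; apply: eq_bigr => i _; rewrite addrK.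
by case: Xiid => _; exact.
Qed.

(** [T] carries no time shift, so the queue is transported to path space, where stationarity becomes
    invariance of [input_law]. *)
Definition input (t : T) : pathT R * pathT R := (path_rv Y t, path_rv eps t).

Lemma measurable_input : measurable_fun [set: T] input.
Proof. by apply/measurable_fun_pair; exact: measurable_path_rv. Qed.

Definition input_law : probability (pathT R * pathT R)%type R :=
  image_probability P measurable_input.

Lemma waitingE w n t : waiting Y eps w n t = lindley w n (input t).
Proof. by elim: n => // n IH; rewrite waitingSE IH. Qed.

Hypothesis Y_stationary : strictly_stationary P Y.
Hypothesis eps_iid : iid P eps.
Hypothesis Y_eps_independent : independent_processes P Y eps.

Lemma input_lawE (A : set (pathT R * pathT R)%type) : measurable A ->
  input_law A = (process_law Y \x process_law eps)%E A.
Proof.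
move=> mA; apply/esym.
exact: (independent_product_law (measurable_path_rv Y) (measurable_path_rv eps)).
Qed.

Lemma input_law_shift k (A : set (pathT R * pathT R)%type) : measurable A ->
  input_law (joint_shift k @^-1` A) = input_law A.
Proof.
move=> mA; rewrite !input_lawE//; last first.
  by rewrite -[X in measurable X]setTI; exact: measurable_joint_shift.
apply: (@joint_inv R (process_law Y) (process_law eps)) => // l B mB.
exact: process_law_shift_iid.
Qed.

Lemma input_law_zero_one (B : set (pathT R * pathT R)%type) : ergodic P Y ->
  measurable B -> joint_shift 1 @^-1` B = B -> finite_change_invariant B ->
  input_law B = 0%E \/ input_law B = 1%E.
Proof.
move=> Yerg mB B1 Btail; rewrite input_lawE//.
apply: (@joint_zero_one R (process_law Y) (process_law eps)) => //.
- by move=> k A mA; exact: process_law_shift_iid.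
- exact: independent_coordinates_iid.
Qed.

Variable alpha : R.

(** Induction on [n]: the last variable is independent of the path with its coordinate erased, which
    still determines the first [n] summands. *)
Lemma expectation_exp_eps n :
  (\int[P]_t (expR (- alpha * \sum_(0 <= i < n) eps i.+1%:Z t))%:E =
   (\int[P]_t (expR (- alpha * eps 1 t))%:E) ^+ n)%E.
Proof.
elim: n => [|n IH].
  under eq_integral do rewrite big_geq// mulr0 expR0.
  by rewrite integral_cst// mul1e; exact: probability_setT.
have mexp : measurable_fun setT (fun x : R => (expR (- alpha * x))%:E).
  by apply/measurable_EFinP; exact: measurableT_comp.
pose g (e : pathT R) := (expR (- alpha * \sum_(0 <= i < n) e i.+1%:Z))%:E.
have mg : measurable_fun setT g.
  apply/measurable_EFinP; apply: measurableT_comp => //.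
  by apply: measurable_funM => //; apply: measurable_sum => i; exact: measurable_coord.
pose s := [:: n.+1%:Z].
pose Z t := zero_on s (path_rv eps t).
have mZ : measurable_fun setT Z.
  by apply: measurableT_comp; [exact: measurable_zero_on|exact: measurable_path_rv].
have gZ t : g (Z t) = (expR (- alpha * \sum_(0 <= i < n) eps i.+1%:Z t))%:E.
  rewrite /g; congr (expR (_ * _))%:E; apply: eq_big_nat => i /andP[_ ilt].
  by rewrite /Z /zero_on inE ifF//; apply/negP => /eqP; lia.
have epsE : (\int[P]_t (expR (- alpha * eps n.+1%:Z t))%:E =
    \int[P]_t (expR (- alpha * eps 1 t))%:E)%E.
  transitivity (\int[distribution P (eps n.+1%:Z)]_x (expR (- alpha * x))%:E)%E.
    by rewrite ge0_integral_distribution// => x; rewrite lee_fin expR_ge0.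
  transitivity (\int[distribution P (eps 1)]_x (expR (- alpha * x))%:E)%E; last first.
    by rewrite ge0_integral_distribution// => x; rewrite lee_fin expR_ge0.
  by apply: eq_measure_integral => A mA _; case: eps_iid => _; exact.
rewrite expeS -IH -epsE.
transitivity (\int[P]_t ((expR (- alpha * eps n.+1%:Z t))%:E * g (Z t)))%E.
  apply: eq_integral => t _; rewrite gZ -EFinM -expRD -mulrDr.
  by rewrite big_nat_recr//= addrC.
rewrite (@independent_expectation _ _ _ T _ _ R P (eps n.+1%:Z) Z _ mZ _
  (fun x => (expR (- alpha * x))%:E) g)//.
- by congr (_ * _)%E; apply: eq_integral => t _; rewrite gZ.
- move=> A B mA mB.
  have := independent_zero_on (independent_coordinates_iid eps_iid) (isT : uniq s)
    (fun=> mA) mB.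
  rewrite (_ : cylinder s (fun=> A) = (fun y : pathT R => y n.+1%:Z) @^-1` A)//.
  apply/seteqP; split=> y; first by apply; rewrite inE.
  by move=> Ay i; rewrite inE => /eqP ->.
- by move=> x; rewrite lee_fin expR_ge0.
Qed.

(** Lindley's recursion consumes [Y_0, ..., Y_(n-1)] whereas [gamma_bar] is written with
    [Y_1, ..., Y_n]; stationarity reconciles the two. *)
Lemma expectation_exp_Y_shift n :
  (\int[P]_t (expR (alpha * \sum_(0 <= i < n) Y i%:Z t))%:E =
   \int[P]_t (expR (alpha * \sum_(1 <= k < n.+1) Y k%:Z t))%:E)%E.
Proof.
pose g (y : pathT R) := (expR (alpha * \sum_(0 <= i < n) y i%:Z))%:E.
have mg : measurable_fun setT g.
  apply/measurable_EFinP; apply: measurableT_comp => //.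
  by apply: measurable_funM => //; apply: measurable_sum => i; exact: measurable_coord.
have g0 y : (0 <= g y)%E by rewrite lee_fin expR_ge0.
pose Y1 : int -> {RV P >-> R} := fun n => Y (n + 1).
transitivity (\int[process_law Y]_y g y)%E.
  by rewrite (ge0_integral_pushforward (measurable_path_rv Y)).
transitivity (\int[process_law Y1]_y g y)%E.
  by apply: eq_measure_integral => A mA _; exact: (esym (Y_stationary 1 mA)).
rewrite (ge0_integral_pushforward (measurable_path_rv Y1))//.
apply: eq_integral => t _; rewrite /g /= big_add1/=.
congr (expR (_ * _))%:E; apply: eq_bigr => i _.
by rewrite /path_rv /path_of /Y1 -addn1 PoszD.
Qed.

Lemma expectation_exp_walk n :
  (\int[P]_t (expR (alpha * walk n (input t)))%:E =
   (\int[P]_t (expR (alpha * \sum_(1 <= k < n.+1) Y k%:Z t))%:E) *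
   (\int[P]_t (expR (- alpha * eps 1 t))%:E) ^+ n)%E.
Proof.
rewrite -expectation_exp_Y_shift -expectation_exp_eps.
pose f (y : pathT R) := (expR (alpha * \sum_(0 <= i < n) y i%:Z))%:E.
pose g (e : pathT R) := (expR (- alpha * \sum_(0 <= i < n) e i.+1%:Z))%:E.
have mf : measurable_fun setT f.
  apply/measurable_EFinP; apply: measurableT_comp => //.
  by apply: measurable_funM => //; apply: measurable_sum => i; exact: measurable_coord.
have mg : measurable_fun setT g.
  apply/measurable_EFinP; apply: measurableT_comp => //.
  by apply: measurable_funM => //; apply: measurable_sum => i; exact: measurable_coord.
transitivity (\int[P]_t (f (path_rv Y t) * g (path_rv eps t)))%E.
  apply: eq_integral => t _; rewrite -EFinM -expRD mulNr -mulrBr -sumrB.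
  by [].
apply: (independent_expectation (measurable_path_rv Y) (measurable_path_rv eps)) => //.
- by move=> y; rewrite lee_fin expR_ge0.
- by move=> y; rewrite lee_fin expR_ge0.
Qed.

Variable M : R.
Hypothesis alpha_ge0 : 0 <= alpha.
Hypothesis eps_ge0 : forall n t, 0 <= eps n t.
Hypothesis Y_bounded : forall n t, 0 <= Y n t <= M.

Definition laplace_eps : R := fine (\int[P]_t (expR (- alpha * eps 1 t))%:E).
Definition mgf_Y n : R := \int[P]_t expR (alpha * \sum_(1 <= k < n.+1) Y k%:Z t).

Lemma measurable_sum_Y n :
  measurable_fun [set: T] (fun t => \sum_(1 <= k < n.+1) Y k%:Z t).
Proof. by apply: measurable_sum => k; exact: measurable_funP. Qed.

Lemma sum_Y_bounded n t : `|\sum_(1 <= k < n.+1) Y k%:Z t| <= n%:R * M.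
Proof.
rewrite (le_trans (ler_norm_sum _ _ _))//.
rewrite (@le_trans _ _ (\sum_(1 <= k < n.+1) M))//.
  by apply: ler_sum => k _; have /andP[? ?] := Y_bounded k%:Z t; rewrite ger0_norm.
by rewrite sumr_const_nat subn1 mulr_natl.
Qed.

Lemma integrable_exp_sum_Y n : P.-integrable [set: T]
  (EFin \o (fun t => expR (alpha * \sum_(1 <= k < n.+1) Y k%:Z t))).
Proof.
apply: (@integrable_bounded _ _ _ _ _ (expR (`|alpha| * (n%:R * M)))).
  apply: measurableT_comp => //; apply: measurable_funM => //.
  exact: measurable_sum_Y.
move=> t; rewrite ger0_norm ?expR_ge0// ler_expR (le_trans (ler_norm _))//.
by rewrite normrM ler_wpM2l// sum_Y_bounded.
Qed.

Lemma mgf_YE n : (\int[P]_t (expR (alpha * \sum_(1 <= k < n.+1) Y k%:Z t))%:E =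
  (mgf_Y n)%:E)%E.
Proof.
by rewrite fineK//; apply: integrable_fin_num => //; exact: integrable_exp_sum_Y.
Qed.

Lemma integrable_exp_eps : P.-integrable [set: T]
  (EFin \o (fun t => expR (- alpha * eps 1 t))).
Proof.
apply: (@integrable_bounded _ _ _ _ _ 1).
  by apply: measurableT_comp => //; exact: measurable_funM.
move=> t; rewrite ger0_norm ?expR_ge0// -expR0 ler_expR mulNr oppr_le0.
exact: mulr_ge0.
Qed.

Lemma laplace_epsE :
  (\int[P]_t (expR (- alpha * eps 1 t))%:E = laplace_eps%:E)%E.
Proof.
by rewrite fineK//; apply: integrable_fin_num => //; exact: integrable_exp_eps.
Qed.

Lemma laplace_eps_ge0 : 0 <= laplace_eps.
Proof. by apply: fine_ge0; apply: integral_ge0 => t _; rewrite lee_fin expR_ge0. Qed.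

Lemma mgf_Y_ge1 n : 1 <= mgf_Y n.
Proof.
rewrite -[leLHS](Rintegral_probability_cst P); apply: le_Rintegral => //.
- exact: integrable_constant.
- exact: integrable_exp_sum_Y.
- move=> t _; rewrite -expR0 ler_expR mulr_ge0// sumr_ge0// => k _.
  by have /andP[] := Y_bounded k%:Z t.
Qed.

Lemma gammaE y : gamma P eps alpha y = expR (alpha * y) * laplace_eps.
Proof.
rewrite /gamma unlock -RintegralZl//; last exact: integrable_exp_eps.
by apply: eq_Rintegral => t _; rewrite -expRD mulrBr mulNr.
Qed.

(** Closed form of the expectation under the root in [gamma_bar], since [gamma] factors as
    [expR (alpha * y)] times a constant. *)
Definition gamma_moment n : R := expR (alpha * M) * (laplace_eps ^+ n * mgf_Y n).

Lemma gamma_moment_ge0 n : 0 <= gamma_moment n.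
Proof.
rewrite mulr_ge0 ?expR_ge0// mulr_ge0 ?exprn_ge0 ?laplace_eps_ge0//.
by rewrite (le_trans ler01)// mgf_Y_ge1.
Qed.

Lemma gamma_momentE n :
  ('E_P[fun t => (expR (alpha * M) *
     \prod_(1 <= k < n.+1) gamma P eps alpha (Y k%:Z t))%R] =
   (gamma_moment n)%:E)%E.
Proof.
rewrite unlock /gamma_moment mulrA EFinM -mgf_YE -integralZl//; last first.
  exact: integrable_exp_sum_Y.
apply: eq_integral => t _; rewrite -EFinM -mulrA; congr (_ * _)%:E.
under eq_bigr do rewrite gammaE.
rewrite big_split/= prodr_const_nat subn1/= mulrC; congr (_ * _).
by rewrite mulr_sumr expR_sum.
Qed.

Lemma walk_tail w n :
  (input_law [set z | (0 < w + walk n z)%R] <=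
   (expR (alpha * w) * gamma_moment n)%:E)%E.
Proof.
rewrite image_probabilityE.
have mA : measurable (input @^-1` [set z | 0 < w + walk n z]).
  rewrite -[X in measurable X]setTI; apply: measurable_input => //.
  exact: measurable_walk_gt0.
have mW : measurable_fun setT (fun t => expR (alpha * walk n (input t))).
  apply: measurableT_comp => //; apply: measurable_funM => //.
  exact: measurableT_comp (measurable_walk n) measurable_input.
rewrite -[X in P X]setIT -integral_indic//.
(* Markov's inequality: the indicator of the event is at most [expR (alpha * (w + walk))]. *)
apply: (@le_trans _ _ ((expR (alpha * w))%:E *
    \int[P]_t (expR (alpha * walk n (input t)))%:E)%E).
  rewrite -ge0_integralZl ?lee_fin ?expR_ge0//; last exact/measurable_EFinP.
  apply: ge0_le_integral => //.
  - exact/measurable_EFinP.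
  - by apply/measurable_EFinP; exact: measurable_funM.
  - move=> t _; rewrite -EFinM lee_fin -expRD -mulrDr indicE.
    have [/set_mem/= tA|_] := boolP (t \in _); last exact: expR_ge0.
    by rewrite -expR0 ler_expR mulr_ge0// ltW.
rewrite expectation_exp_walk mgf_YE laplace_epsE -EFin_expe -!EFinM lee_fin.
(* The constant [expR (alpha * M)] in [gamma_moment] is at least 1, so inserting it only enlarges
   the bound. *)
rewrite /gamma_moment ler_wpM2l ?expR_ge0// mulrC ler_peMl//.
  rewrite mulr_ge0 ?exprn_ge0 ?laplace_eps_ge0//.
  by rewrite (le_trans ler01)// mgf_Y_ge1.
rewrite -expR0 ler_expR mulr_ge0//.
by have /andP[/le_trans] := Y_bounded 0 point; exact.
Qed.

End queue_input.

(** Some tail supremum of the roots is below 1, which gives geometric decay from there on; the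
    constant covers the finitely many earlier terms. *)
Lemma root_test (R : realType) (A : nat -> R) : (forall n, 0 <= A n) ->
  (limn_esup (fun n => (A n)%:E `^ n%:R^-1) < 1)%E ->
  exists C r, [/\ 0 <= C, 0 < r, r < 1 & forall n, A n <= C * r ^+ n].
Proof.
move=> A0; rewrite limn_esup_lim => lim1.
have [N hN] : exists N, (esups (fun n => (A n)%:E `^ n%:R^-1) N < 1)%E.
  apply: contrapT => /forallNP hN; move: lim1; apply/negP; rewrite -leNgt.
  apply: lime_ge; first exact: is_cvg_esups.
  by apply: nearW => n; rewrite leNgt; apply/negP; exact: hN.
have u_le n : (N <= n)%N ->
    ((A n)%:E `^ n%:R^-1 <= esups (fun n => (A n)%:E `^ n%:R^-1) N)%E.
  by move=> Nn; apply: ereal_sup_ubound; exists n.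
move: (esups _ N) hN u_le => rho rho1 u_le.
have rho0 : (0 <= rho)%E by rewrite (le_trans _ (u_le N (leqnn N)))// poweR_ge0.
have rhoE : rho = (fine rho)%:E.
  by rewrite fineK// ge0_fin_numE// (lt_trans rho1)// ltry.
(* The maximum with 1/2 keeps [r] positive when [rho] is 0. *)
pose r := Num.max (fine rho) 2^-1.
have r0 : 0 < r by rewrite lt_max invr_gt0 ltr0n orbT.
have r1 : r < 1.
  rewrite gt_max -lte_fin -rhoE rho1/= invf_lt1// ltr1n//.
have Ar n : (N < n)%N -> A n <= r ^+ n.
  move=> Nn; have n0 : n%:R != 0 :> R by rewrite pnatr_eq0 -lt0n (leq_trans _ Nn).
  have := u_le n (ltnW Nn); rewrite rhoE poweR_EFin lee_fin => h.
  rewrite -[leLHS]powRr1// -(mulVf n0) powRrM powR_mulrn ?powR_ge0//.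
  by rewrite lerXn2r ?nnegrE ?powR_ge0 ?(ltW r0)// (le_trans h)// le_max lexx.
(* The summand 1 serves the indices beyond [N], the sum serves those up to [N]. *)
exists (1 + \sum_(0 <= k < N.+1) A k / r ^+ k), r.
have t0 k : 0 <= A k / r ^+ k by rewrite divr_ge0// exprn_ge0// ltW.
split=> //; first by rewrite addr_ge0// sumr_ge0.
move=> n; have [nN|Nn] := leqP n N.
  rewrite -ler_pdivrMr ?exprn_gt0//.
  rewrite (bigD1_seq n) ?mem_index_iota ?iota_uniq//=.
  by rewrite addrCA lerDl addr_ge0// sumr_ge0.
rewrite (le_trans (Ar n Nn))// ler_peMl ?exprn_ge0 ?(ltW r0)//.
by rewrite lerDl sumr_ge0.
Qed.

(** * Existence of the exponent *)

Section existence_of_exponent.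
Context (d : measure_display) (T : measurableType d) (R : realType)
  (P : probability T R) (M : R) (Y eps : int -> {RV P >-> R}).
Hypothesis Y_stationary : strictly_stationary P Y.
Hypothesis eps_ge0 : forall n t, 0 <= eps n t.
Hypothesis Y_bounded : forall n t, 0 <= Y n t <= M.

Let m := \int[P]_t Y 0 t.

Let normY k t : `|Y k t| <= M.
Proof. by have /andP[? ?] := Y_bounded k t; rewrite ger0_norm. Qed.

Lemma mean_Y k : \int[P]_t Y k t = m.
Proof.
have distE j : \int[P]_t Y j t = fine (\int[distribution P (Y j)]_x x%:E)%E.
  congr fine; rewrite integral_distribution//.
  by apply: (@integrable_bounded _ _ _ _ _ M) => // t; exact: normY.
rewrite /m !distE; congr fine; apply: eq_measure_integral => A mA _.
have mA' : measurable ((fun y : pathT R => y 0) @^-1` A).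
  by rewrite -[X in measurable X]setTI; exact: measurable_coord.
have := Y_stationary k mA'.
rewrite /path_law /path_of /distribution /pushforward /preimage/=.
by under [X in P X = _ -> _]eq_set do rewrite add0r.
Qed.

(** The exponential lies above its tangent at [c], and [a * S] has mean [c]. The sign of [a] is
    free, as needed for a two-sided minimum at 0. *)
Lemma mgf_Y_jensen a n : expR (a * (n%:R * m)) <= mgf_Y Y a n.
Proof.
set c := a * (n%:R * m).
pose S t := \sum_(1 <= k < n.+1) Y k%:Z t.
have mS : measurable_fun setT S by exact: measurable_sum_Y.
have iS : P.-integrable setT (EFin \o S).
  by apply: (integrable_bounded P mS) => t; exact: sum_Y_bounded.
have iaS : P.-integrable setT (EFin \o (fun t => a * S t)).
  apply: (@integrable_bounded _ _ _ _ _ (`|a| * (n%:R * M))).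
    exact: measurable_funM.
  by move=> t; rewrite normrM ler_wpM2l// sum_Y_bounded.
have SE : \int[P]_t S t = n%:R * m.
  rewrite /S; under eq_Rintegral do rewrite big_add1/=.
  rewrite (@Rintegral_sum _ _ _ P (fun k t => Y k.+1%:Z t) M)//.
  under eq_bigr do rewrite mean_Y.
  by rewrite sumr_const_nat subn0 mulr_natl.
have iD : P.-integrable setT (EFin \o (fun t => (1 - c) + a * S t)).
  have := integrableD measurableT (integrable_constant P (1 - c)) iaS.
  by apply: eq_integrable => // x _.
have -> : expR c = \int[P]_t (expR c * ((1 - c) + a * S t)).
  rewrite RintegralZl// (RintegralD measurableT (integrable_constant P (1 - c)) iaS).
  by rewrite Rintegral_probability_cst RintegralZl// SE -/c subrK mulr1.
apply: le_Rintegral => //.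
- have := integrableZl measurableT (expR c) iD.
  by apply: eq_integrable => // x _.
- exact: (integrable_exp_sum_Y a Y_bounded n).
- move=> t _; rewrite -/(S t).
  have -> : expR (a * S t) = expR c * expR (a * S t - c).
    by rewrite -expRD addrC subrK.
  rewrite ler_wpM2l ?expR_ge0// (le_trans _ (expR_ge1Dx _))//.
  by rewrite addrAC addrA.
Qed.

Lemma scaled_log_mgfE a n : scaled_log_mgf P Y a n = n%:R^-1 * ln (mgf_Y Y a n).
Proof. by rewrite /scaled_log_mgf unlock. Qed.

Lemma mgf_Y_gt0 a n : 0 < mgf_Y Y a n.
Proof. by rewrite (lt_le_trans _ (mgf_Y_jensen a n))// expR_gt0. Qed.

Lemma Gamma_ge a : cvgn (scaled_log_mgf P Y a) -> a * m <= Gamma P Y a.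
Proof.
move=> cG; apply: limr_ge => //; near=> n.
have n0 : 0 < n%:R :> R by rewrite ltr0n; near: n; exists 1%N.
rewrite scaled_log_mgfE ler_pdivlMl// -ler_expR lnK ?posrE ?mgf_Y_gt0//.
by rewrite mulrCA mgf_Y_jensen.
Unshelve. all: by end_near.
Qed.

Lemma Gamma0 : Gamma P Y 0 = 0.
Proof.
rewrite /Gamma (_ : scaled_log_mgf P Y 0 = cst 0) ?lim_cst//.
apply/funext => n; rewrite scaled_log_mgfE /mgf_Y.
under eq_Rintegral do rewrite mul0r expR0.
by rewrite Rintegral_probability_cst ln1 mulr0.
Qed.

Variable eta : R.
Hypothesis eta_gt0 : 0 < eta.
Hypothesis Gamma_exists :
  forall a : R, - eta < a < eta -> cvgn (scaled_log_mgf P Y a).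
Hypothesis Gamma_derivable :
  forall a : R, - eta < a < eta -> derivable (Gamma P Y) a 1.

(* [Gamma a - a m] is nonnegative by Jensen and vanishes at [0]. *)
Lemma is_derive_Gamma0 : is_derive (0 : R) 1 (Gamma P Y) m.
Proof.
have d0 : derivable (Gamma P Y) 0 1 by apply: Gamma_derivable; rewrite oppr_lt0 eta_gt0.
pose g a := Gamma P Y a - a * m.
have dlin (a : R) : is_derive a 1 (fun a : R => a * m) m.
  apply: is_derive_eq; by rewrite ?scaler0 ?addr0 ?add0r /GRing.scale/= ?mulr1.
have : is_derive (0 : R) 1 g 0.
  apply: (@derive1_at_min _ g (- eta) eta).
  - by rewrite ltW// (lt_trans _ eta_gt0)// oppr_lt0.
  - move=> t; rewrite in_itv/= => te; apply: derivableB.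
      exact: Gamma_derivable.
    by have [] := dlin t.
  - by rewrite in_itv/= oppr_lt0 eta_gt0.
  - move=> t; rewrite in_itv/= => te; rewrite /g mul0r subr0 Gamma0 subr_ge0.
    by apply: Gamma_ge; exact: Gamma_exists.
move=> dg.
have -> : Gamma P Y = g + (fun a : R => a * m).
  by apply/funext => a; rewrite /g/= fctE subrK.
by have := is_deriveD dg (dlin 0); rewrite add0r.
Qed.

Let t_ n : R := n.+1%:R^-1.
Let t_gt0 n : 0 < t_ n. Proof. by rewrite invr_gt0. Qed.
Let t_cvg0 : t_ n @[n --> \oo] --> (0 : R).
Proof. exact: cvg_harmonic. Qed.

(** Caratheodory's slope function [g] writes the expression as [g (x * t_ n) * x], which avoids
    dividing by [x] when it is 0. *)
Lemma difference_quotient_cvg (f : R -> R) (l x : R) : is_derive (0 : R) 1 f l ->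
  n.+1%:R * (f (x * t_ n) - f 0) @[n --> \oo] --> l * x.
Proof.
move=> /is_derive1_caratheodory[g [fg cg <-]].
have -> : (fun n : nat => n.+1%:R * (f (x * t_ n) - f 0)) =
    (fun n => g (x * t_ n) * x).
  apply/funext => n; rewrite fg subr0 mulrCA; congr (_ * _).
  by rewrite mulrCA /t_ divff ?mulr1// pnatr_eq0.
have h : x * t_ n @[n --> \oo] --> (0 : R).
  by rewrite -[X in _ --> X](mulr0 x); exact: cvgMr.
by apply: cvgMl; exact: (cvg_comp _ _ h cg).
Qed.

(** The nonnegative functions [(1 - exp(- t x)) / t] tend to [x] as [t] tends to 0. Fatou's lemma
    also covers an infinite mean of [eps 1]. *)
Lemma laplace_eps_fatou :
  ('E_P[eps 1] <= limn_einf (fun n => (n.+1%:R * (1 - laplace_eps eps (t_ n)))%:E))%E.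
Proof.
pose f n t := (n.+1%:R * (1 - expR (- t_ n * eps 1 t)))%:E.
have mf n : measurable_fun setT (f n).
  apply/measurable_EFinP; apply: measurable_funM => //.
  apply: measurable_funB => //; apply: measurableT_comp => //.
  exact: measurable_funM.
have f0 n t : setT t -> (0 <= f n t)%E.
  move=> _; rewrite lee_fin mulr_ge0// subr_ge0 -expR0 ler_expR mulNr oppr_le0.
  by rewrite mulr_ge0// ltW.
have := fatou P measurableT mf f0.
have -> : (fun n => \int[P]_t f n t)%E =
    (fun n => (n.+1%:R * (1 - laplace_eps eps (t_ n)))%:E).
  apply/funext => n.
  have ie : P.-integrable setT (EFin \o (fun t => expR (- t_ n * eps 1 t))).
    by apply: integrable_exp_eps => //; exact: ltW.
  have iB : P.-integrable setT (EFin \o (fun t => 1 - expR (- t_ n * eps 1 t))).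
    have := integrableB measurableT (integrable_constant P 1) ie.
    by apply: eq_integrable => // x _.
  rewrite /f; under eq_integral do rewrite EFinM.
  rewrite (integralZl measurableT iB) EFinM; congr (_ * _)%E.
  rewrite /= (integralB_EFin measurableT (integrable_constant P 1) ie).
  rewrite integral_cst// laplace_epsE//; last exact: ltW.
  by rewrite [X in (_ * X)%E](_ : _ = 1%E) ?mule1//; exact: probability_setT.
apply: le_trans; rewrite unlock le_eqVlt; apply/orP; left; apply/eqP.
apply: eq_integral => t _; apply/esym.
have : (fun n => f n t) @ \oo --> (eps 1 t)%:E.
  apply: cvg_EFin; first exact: nearW.
  have := @difference_quotient_cvg _ _ (- eps 1 t) (is_derive_expR 0).
  move=> /(@cvgN _ _ _ _ _ _ _); rewrite expR0 mul1r opprK; apply: cvg_trans.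
  apply: near_eq_cvg; apply: nearW => n /=.
  rewrite -[LHS]/(- (n.+1%:R * (expR (- eps 1 t * t_ n) - 1))) -mulrN opprB.
  by rewrite [- eps 1 t * _]mulNr [eps 1 t * _]mulrC -mulNr.
by move/cvg_limn_einf_sup => -[].
Qed.

Lemma laplace_eps_le a : laplace_eps eps a <= expR (laplace_eps eps a - 1).
Proof. by rewrite (le_trans _ (expR_ge1Dx _))// addrC subrK. Qed.

Lemma gamma_bar_lt1 a : 0 <= a -> cvgn (scaled_log_mgf P Y a) ->
  Gamma P Y a + laplace_eps eps a - 1 < 0 -> (gamma_bar P Y eps M a < 1)%E.
Proof.
move=> a0 cG s_lt0; set s := _ - 1 in s_lt0.
(* [expR (v n)] bounds the [n]-th root of [gamma_moment]: the three terms come from the constant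
   factor, from [x <= exp(x - 1)] for the Laplace transform, and from the moment generating
   function. *)
pose v n := a * M * n%:R^-1 + (laplace_eps eps a - 1) + scaled_log_mgf P Y a n.
have v_cvg : v n @[n --> \oo] --> s.
  have -> : s = 0 + (laplace_eps eps a - 1) + Gamma P Y a by rewrite /s; ring.
  apply: cvgD => //; apply: cvgD; last exact: cvg_cst.
  rewrite -[X in _ --> X](mulr0 (a * M)); apply: cvgMr.
  by apply/gtr0_cvgV0; [near=> n; rewrite ltr0n; near: n; exists 1%N|exact: cvgr_idn].
(* As [s] is negative, [s / 2] is still negative and leaves room above the limit of [v]. *)
have s2 : s < s / 2 by lra.
have [N _ hN] := cvgr_lt _ v_cvg _ s2.
have u_le n : (N.+1 <= n)%N ->
    ((gamma_moment Y eps a M n)%:E `^ n%:R^-1 <= (expR (s / 2))%:E)%E.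
  move=> Nn; have n0 : 0 < n%:R :> R by rewrite ltr0n (leq_trans _ Nn).
  rewrite poweR_EFin lee_fin.
  have le1 : gamma_moment Y eps a M n <= expR (n%:R * v n).
    rewrite /v scaled_log_mgfE !mulrDr mulVKf ?gt_eqF// mulrCA divff ?gt_eqF// mulr1.
    rewrite !expRD lnK ?posrE ?mgf_Y_gt0// /gamma_moment -mulrA.
    rewrite ler_wpM2l ?expR_ge0// ler_wpM2r ?(ltW (mgf_Y_gt0 _ _))//.
    rewrite -expRD -mulrDr expRM_natl lerXn2r ?nnegrE ?expR_ge0 ?laplace_eps_ge0//.
    exact: laplace_eps_le.
  rewrite (@le_trans _ _ (expR (n%:R * v n) `^ n%:R^-1))//.
    rewrite ge0_ler_powR ?invr_ge0 ?nnegrE ?expR_ge0//.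
    exact: (gamma_moment_ge0 _ _ Y_bounded).
  rewrite -expRM mulrAC divff ?gt_eqF// mul1r ler_expR ltW//.
  by apply: hN; exact: ltnW.
rewrite /gamma_bar.
under [X in limn_esup X]eq_fun do rewrite (gamma_momentE a0 eps_ge0 Y_bounded).
rewrite limn_esup_lim (@le_lt_trans _ _ (expR (s / 2))%:E)//; last first.
  by rewrite lte_fin -[ltRHS]expR0 ltr_expR; lra.
apply: lime_le; first exact: is_cvg_esups.
exists N.+1 => // k /= Nk; apply: ge_ereal_sup => _ [j /= kj <-].
by apply: u_le; rewrite (leq_trans Nk).
Unshelve. all: by end_near.
Qed.

(** Along [t_ k] the scaled [Gamma] tends to [m], while the scaled [1 - laplace_eps] stays above
    some [c > m]; so [Gamma + laplace_eps - 1] is eventually negative. *)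
Lemma exists_exponent : ('E_P[Y 0] < 'E_P[eps 1])%E ->
  exists alpha : R, 0 < alpha /\ (gamma_bar P Y eps M alpha < 1)%E.
Proof.
move=> mean_lt.
have mE : ('E_P[Y 0] = m%:E)%E.
  rewrite unlock fineK//; apply: integrable_fin_num => //.
  by apply: (integrable_bounded P (b := M)) => // t; exact: normY.
have := lt_le_trans mean_lt laplace_eps_fatou; rewrite mE limn_einf_lim => lim_gt.
set u := fun n : nat => _ in lim_gt.
have [N hN] : exists N, (m%:E < einfs u N)%E.
  apply: contrapT => /forallNP hN; move: lim_gt; apply/negP; rewrite -leNgt.
  apply: lime_le; first exact: is_cvg_einfs.
  by apply: nearW => n; rewrite leNgt; apply/negP; exact: hN.
have uN k : (N <= k)%N -> (einfs u N <= u k)%E.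
  by move=> Nk; apply: ereal_inf_lbound; exists k.
have [c mc cN] : exists2 c : R, m < c & forall k, (N <= k)%N ->
    c <= k.+1%:R * (1 - laplace_eps eps (t_ k)).
  (* The infimum is real: it exceeds [m] and is at most the real value [u N]. *)
  case: (einfs u N) hN uN => [x|_ uN|//].
    by rewrite lte_fin => mx uN; exists x => // k /uN.
  by have := uN N (leqnn N); rewrite leye_eq.
have G_cvg := @difference_quotient_cvg _ _ 1 is_derive_Gamma0.
rewrite mulr1 Gamma0 in G_cvg.
have [N1 _ hN1] := cvgr_lt _ G_cvg _ mc.
have [N2 _ hN2] := cvgr_lt _ t_cvg0 _ eta_gt0.
(* Beyond all three thresholds: the Fatou bound, the derivative of [Gamma] at 0, and
   [t_ k < eta]. *)
pose k := (N + N1 + N2)%N.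
have tk : - eta < t_ k < eta.
  rewrite (hN2 k) ?andbT//=; last by rewrite leq_addl.
  by rewrite (lt_trans _ (t_gt0 k))// oppr_lt0.
exists (t_ k); split => //; apply: gamma_bar_lt1; [exact: ltW|exact: Gamma_exists|].
have k0 : 0 < k.+1%:R :> R by [].
rewrite -(pmulr_rlt0 _ k0).
have := hN1 k; rewrite /= mul1r subr0 => /(_ _).
have := cN k; rewrite /k => /(_ _) h1 h2.
have {}h1 := h1 (leq_trans (leq_addr N1 N) (leq_addr _ _)).
have {}h2 := h2 (leq_trans (leq_addl N N1) (leq_addr _ _)).
move: h1 h2; rewrite -/k; set G := Gamma _ _ _; set l := laplace_eps _ _.
have -> : k.+1%:R * (G + l - 1) = k.+1%:R * G - k.+1%:R * (1 - l) by ring.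
lra.
Qed.

End existence_of_exponent.

(** * The theorem *)

Section Lp_convergence.
Context d (T : measurableType d) (R : realType) (P : probability T R).

(** Interpolation between L^1 and the uniform bound: [|X|^p <= B^(p-1) |X|]. *)
Lemma Lnorm_le_Rintegral (X : T -> R) (B p : R) : measurable_fun [set: T] X ->
  (forall t, `|X t| <= B) -> 1 <= p ->
  ('N[P]_p%:E[(fun t => (X t)%:E)] <=
   ((B `^ (p - 1) * \int[P]_t `|X t|) `^ p^-1)%:E)%E.
Proof.
move=> mX XB p1; have p0 : 0 < p by rewrite (lt_le_trans ltr01).
have B0 : 0 <= B by rewrite (le_trans (normr_ge0 (X point))).
have maX : measurable_fun setT (fun t => `|X t|) by exact: measurableT_comp.
have iX : P.-integrable setT (EFin \o (fun t => `|X t|)).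
  by apply: (@integrable_bounded _ _ _ _ _ B) => // t; rewrite normr_id.
rewrite unlock -poweR_EFin.
have le_pow t : `|X t| `^ p <= B `^ (p - 1) * `|X t|.
  have [->|Xt] := eqVneq (X t) 0; first by rewrite normr0 powR0 ?gt_eqF// mulr0.
  have -> : `|X t| `^ p = `|X t| `^ (p - 1) * `|X t|.
    rewrite -[in LHS](subrK 1 p) [LHS]powRD; first by rewrite powRr1.
    by rewrite normr_eq0 Xt implybT.
  by rewrite ler_wpM2r// ge0_ler_powR ?nnegrE ?subr_ge0.
pose I := \int[P]_t `|X t|.
have le_int : (\int[P]_t (`|(X t)%:E| `^ p) <= (B `^ (p - 1) * I)%:E)%E.
  have -> : ((B `^ (p - 1) * I)%:E = \int[P]_t (B `^ (p - 1) * `|X t|)%:E)%E.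
    rewrite EFinM fineK; last exact: integrable_fin_num.
    by rewrite -(integralZl measurableT iX).
  apply: ge0_le_integral => //.
  - by move=> t _; rewrite poweR_ge0.
  - under eq_fun do rewrite abse_EFin poweR_EFin.
    by apply/measurable_EFinP; exact: measurableT_comp (measurable_powR p) maX.
  - by apply/measurable_EFinP; exact: measurable_funM.
  - by move=> t _; rewrite abse_EFin poweR_EFin lee_fin.
apply: gt0_ler_poweR => //; first by rewrite invr_ge0 ltW.
- by rewrite in_itv/= leey andbT integral_ge0// => t _; rewrite poweR_ge0.
- by rewrite in_itv/= leey andbT lee_fin mulr_ge0 ?powR_ge0// Rintegral_ge0.
Qed.

Lemma Lnorm_cvg0 (X : nat -> T -> R) (B p : R) :
  (forall n, measurable_fun [set: T] (X n)) -> (forall n t, `|X n t| <= B) ->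
  1 <= p -> \int[P]_t `|X n t| @[n --> \oo] --> (0 : R) ->
  (fun n => 'N[P]_p%:E[(fun t => (X n t)%:E)]%E) @ \oo --> 0%E.
Proof.
move=> mX XB p1 cX; have p0 : 0 < p by rewrite (lt_le_trans ltr01).
have {}cX : B `^ (p - 1) * \int[P]_t `|X n t| @[n --> \oo] --> (0 : R).
  by rewrite -[X in _ --> X](mulr0 (B `^ (p - 1))); exact: cvgMr.
apply: (@squeeze_cvge _ _ _ _ (cst 0%E) _
  (fun n => ((B `^ (p - 1) * \int[P]_t `|X n t|) `^ p^-1)%:E)).
- by apply: nearW => n; rewrite Lnorm_ge0 Lnorm_le_Rintegral.
- exact: cvg_cst.
apply: cvg_EFin; first exact: nearW.
apply/cvgrPdist_le => e e0; near=> n.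
rewrite sub0r normrN ger0_norm ?powR_ge0//=.
rewrite (@le_trans _ _ ((e `^ p) `^ p^-1))//; last first.
  by rewrite -powRrM divff ?gt_eqF// powRr1// ltW.
rewrite ge0_ler_powR ?invr_ge0 ?(ltW p0) ?nnegrE ?powR_ge0//.
  by rewrite mulr_ge0 ?powR_ge0// Rintegral_ge0.
rewrite (le_trans (ler_norm _))// -normrN -sub0r; near: n.
by move/cvgrPdist_le : cX; apply; rewrite powR_gt0.
Unshelve. all: by end_near.
Qed.

End Lp_convergence.

(** Since [r ^+ n = exp(n ln r)] with [ln r < 0], it is enough that the cube root of [n] is at most
    [n], which holds for every natural number. *)
Lemma expR_cbrt_ge_geometric (R : realType) (r : R) n : 0 < r -> r < 1 ->
  r ^+ n <= expR (- (- ln r) * n%:R `^ (3^-1)).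
Proof.
move=> r0 r1; rewrite opprK -{1}(@lnK _ r) ?posrE// -expRM_natl ler_expR mulrC.
rewrite ler_wnM2l ?ln_le0 ?(ltW r1)//.
case: n => [|n]; first by rewrite powR0// invr_neq0.
rewrite -[leRHS]powRr1//; apply: ler_powR; first by rewrite ler1n.
by rewrite invf_le1// ler1n.
Qed.

Theorem theorem4p7 (R : realType) (d : measure_display) (T : measurableType d)
    (P : probability T R) (M : R) (eps Y : int -> {RV P >-> R}) (eta : R)
    (M_gt0 : 0 < M)
    (eps_iid : iid P eps)
    (eps_ge0 : forall n t, 0 <= eps n t)
    (Y_stationary : strictly_stationary P Y)
    (Y_bounded : forall n t, 0 <= Y n t <= M)
    (Y_eps_independent : independent_processes P Y eps)
    (mean_lt : ('E_P[Y 0%R] < 'E_P[eps 1%R])%E)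
    (eta_gt0 : 0 < eta)
    (Gamma_exists : forall a : R, - eta < a < eta -> cvgn (scaled_log_mgf P Y a))
    (Gamma_derivable : forall a : R, - eta < a < eta -> derivable (Gamma P Y) a 1) :
  (exists alpha : R, 0 < alpha /\ (gamma_bar P Y eps M alpha < 1)%E) /\
  forall alpha : R, 0 < alpha ->
    (gamma_bar P Y eps M alpha < 1)%E ->
    (0 < P [set t | tau M (fine (gamma_bar P Y eps M alpha)) <= eps 1 t]%R)%E ->
    exists mu : probability R R,
      mu `[0, +oo[%classic = 1%E /\
      forall w0 : R, 0 <= w0 ->
        (exists c1 c2 : R, [/\ 0 < c1, 0 < c2 & forall n : nat,
           (d_TV (distribution P (waiting Y eps w0 n)) mu <=
            (c1 * expR (- c2 * n%:R `^ (3^-1)))%:E)%E]) /\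
        (ergodic P Y ->
         forall Phi : R -> R,
           measurable_fun (`[0, +oo[%classic : set R) Phi ->
           [bounded Phi x | x in `[0, +oo[%classic] ->
           forall p : R, 1 <= p ->
             (fun n : nat => 'N[P]_p%:E[(fun t =>
                ((\sum_(0 <= i < n) Phi (waiting Y eps w0 i t)) / n%:R
                 - \int[mu]_(z in `[0%R, +oo[) Phi z)%R%:E)]%E)
             @ \oo --> 0%E).
Proof.
split; first exact: exists_exponent Gamma_exists Gamma_derivable mean_lt.
move=> alpha alpha_gt0 gb_lt1 _.
have alpha_ge0 := ltW alpha_gt0.
have A0 := gamma_moment_ge0 eps alpha_ge0 Y_bounded.
have [C [r [C0 r0 r1 Cr]]] : exists C r, [/\ 0 <= C, 0 < r, r < 1 &
    forall n, gamma_moment Y eps alpha M n <= C * r ^+ n].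
  apply: root_test A0 _; move: gb_lt1; rewrite /gamma_bar.
  by under [X in limn_esup X]eq_fun do
    rewrite (gamma_momentE alpha_ge0 eps_ge0 Y_bounded).
pose Q := input_law Y eps.
have Q_inv k A : measurable A -> Q (joint_shift k @^-1` A) = Q A.
  exact: input_law_shift.
have tail w n : 0 <= w ->
    (Q [set z | (0 < w + walk n z)%R] <= (expR (alpha * w) * C * r ^+ n)%:E)%E.
  move=> w0; have := walk_tail Y_stationary eps_iid Y_eps_independent alpha_ge0
    eps_ge0 Y_bounded w n.
  by move=> /le_trans; apply; rewrite lee_fin -mulrA ler_wpM2l ?expR_ge0.
(* This law is built from the input alone, before [w0] is introduced. *)
exists (stationary_law Q); split; first exact: stationary_law_nonneg.
move=> w0 w0_ge0.
have waiting_law n A : distribution P (waiting Y eps w0 n) A =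
    Q (lindley w0 n @^-1` A).
  rewrite -[LHS]/(P (waiting Y eps w0 n @^-1` A)).
  rewrite -[RHS]/(P (input Y eps @^-1` (lindley w0 n @^-1` A))); congr (P _).
  by apply/seteqP; split=> t /=; rewrite waitingE.
split.
  have rate0 := rate_ge0 alpha C0 r1 w0.
  (* The factor 2 comes from [d_TV_le]; adding 1 makes the constant positive even if the rate
     vanishes. *)
  exists (2 * rate alpha C r w0 + 1), (- ln r); split.
  - by rewrite ltr_wpDl// mulr_ge0.
  - by rewrite oppr_gt0 ln_lt0// r0.
  move=> n; apply: le_trans.
    apply: (@d_TV_le _ _ _ (rate alpha C r w0 * r ^+ n)) => A mA.
      have := lindley_law_upper Q_inv C0 r0 r1 tail n w0_ge0 mA.
      by rewrite -waiting_law.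
    have := lindley_law_lower Q_inv C0 r0 r1 tail n w0_ge0 mA.
    by rewrite -waiting_law.
  rewrite lee_fin mulrA ler_pM ?mulr_ge0 ?exprn_ge0 ?(ltW r0)//.
    by rewrite lerDl.
  exact: expR_cbrt_ge_geometric.
move=> Yerg Phi mPhi [B [_ hB]] p p1.
have mI : measurable (`[0, +oo[%classic : set R) by [].
(* [Phi] is measurable and bounded only on the half-line, so it is extended by 0; waiting times are
   nonnegative and do not see the change. *)
pose Psi : R -> R := Phi \_ `[0, +oo[%classic.
have mPsi : measurable_fun setT Psi by exact: (iffLR (measurable_restrictT Phi mI) mPhi).
have PsiE x : 0 <= x -> Psi x = Phi x.
  by move=> x0; rewrite /Psi patchE mem_set//= in_itv/= x0.
(* The boundedness hypothesis gives a bound for each number strictly above [B], hence the added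
   1. *)
pose b := `|B| + 1.
have Psib x : `|Psi x| <= b.
  rewrite /Psi patchE; case: ifPn => [/set_mem x0|_].
    by apply: hB => //; rewrite /b (le_lt_trans (ler_norm B))// ltrDl.
  by rewrite normr0 addr_ge0.
set I := \int[_]_(z in _) _.
have IE : I = \int[stationary_law Q]_z Psi z by rewrite /I Rintegral_mkcond.
pose X n (z : pathT R * pathT R) :=
  (\sum_(0 <= i < n) Psi (lindley w0 i z)) / n%:R - I.
have mX n : measurable_fun setT (X n).
  apply: measurable_funB => //; apply: measurable_funM => //.
  apply: measurable_sum => i; apply: measurableT_comp => //.
  exact: measurable_lindley.
have Xb n z : `|X n z| <= b + `|I|.
  rewrite (le_trans (ler_normB _ _))// lerD2r.
  have [->|n0] := eqVneq n 0%N.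
    by rewrite big_geq// mul0r normr0 (le_trans _ (Psib 0)).
  have n0' : 0 < n%:R :> R by rewrite ltr0n lt0n.
  rewrite normrM normfV (ger0_norm (ltW n0')) ler_pdivrMr// mulrC.
  by apply: (@bounded_sum _ _ _ (fun i z => Psi (lindley w0 i z))).
have Q01 := @input_law_zero_one _ _ _ _ _ _ eps_iid Y_eps_independent ^~ Yerg.
have cX := queue_average_L1 Q_inv C0 r0 r1 tail Q01 mPsi Psib w0_ge0.
have XW n t : X n (input Y eps t) =
    (\sum_(0 <= i < n) Phi (waiting Y eps w0 i t)) / n%:R - I.
  rewrite /X; congr (_ / _ - _); apply: eq_bigr => i _.
  by rewrite PsiE ?lindley_ge0// waitingE.
under eq_cvg do under eq_Lnorm do rewrite -XW.
apply: (@Lnorm_cvg0 _ _ _ P (fun n t => X n (input Y eps t)) (b + `|I|)) => //.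
  by move=> n; exact: measurableT_comp (mX n) (measurable_input Y eps).
(* The L^1 limit on path space is carried back to [P] by change of variables along [input]. *)
move: cX; rewrite -IE; apply: cvg_trans; apply: near_eq_cvg; apply: nearW => n.
congr fine; rewrite (@ge0_integral_pushforward _ _ _ _ _ _ (measurable_input Y eps)
  P setT (fun z => `|X n z|%:E))//.
  by apply/measurable_EFinP; exact: measurableT_comp.
Qed.
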